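(* Let $G$ be a finitely generated group and $H$ a countable nilpotent group, with polynomial maps $p_j,q_j:G\to H$, $j=1,\dots,s$, satisfying $p_j(1_G)=q_j(1_G)=1_H$, and let $A\subseteq H$ satisfy $d_l^*(A)>0$. Then for every left or right Følner sequence $F=(F_N)_{N\in\mathbb{N}}$ in $G$ there is a set $B\subseteq G$ such that $\overline{d}_F(B)>0$ and $$\bigcup_{j=1}^sp_j(B)\, q_j(B)\subseteq AA^{-1}.$$
   Context: For groups $G,H$, a map $\varphi:G\to H$ and $h\in G$, define $D_h\varphi:G\to H$ by $D_h\varphi(g)=\varphi(g)^{-1}\varphi(gh)$. The map $\varphi$ is polynomial if there is $d\in\mathbb{N}$ such that for all $h_1,\dots,h_{d+1}\in G$ the map $D_{h_1}\cdots D_{h_{d+1}}\varphi$ is constantly equal to $1_H$. A left Følner sequence in a countable group $G$ is a sequence $(F_N)_{N\in\mathbb{N}}$ of finite nonempty subsets of $G$ such that $\lim_{N\to\infty}\frac{|gF_N\Delta F_N|}{|F_N|}=0$ for all $g\in G$; it is a right Følner sequence if $\lim_{N\to\infty}\frac{|F_Ng\Delta F_N|}{|F_N|}=0$ for all $g\in G$. $\overline{d}_F(E)=\limsup_{N\to\infty}\frac{|E\cap F_N|}{|F_N|}$. For $A\subseteq H$, $d^*_l(A)=\sup\{\overline{d}_F(A):F\text{ a left Følner sequence in }H\}$. $p_j(B)q_j(B)=\{p_j(b)q_j(b'):b,b'\in B\}$ and $AA^{-1}=\{aa'^{-1}:a,a'\in A\}$. *)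

(* Defs.v *)
From HB Require Import structures.
From mathcomp Require Import all_boot all_order all_algebra finmap.
From mathcomp Require Import all_classical all_reals all_analysis.
Set Implicit Arguments.
Unset Strict Implicit.
Unset Printing Implicit Defensive.
Import Order.TTheory GRing.Theory Num.Theory.
Import numFieldNormedType.Exports.
Local Open Scope classical_set_scope.
Local Open Scope ring_scope.

Definition generated (G : groupType) (S : set G) : set G :=
  smallest (fun K : set G => group_closed (mem K)) S.

Definition finitely_generated (G : groupType) : Prop :=
  exists S : set G, finite_set S /\ generated S = [set: G].

(* Indexed from 0: lower_central 0 = G and
   lower_central n.+1 = [lower_central n, G]. *)
Fixpoint lower_central (G : groupType) (n : nat) : set G :=
  if n is m.+1 then
    generated [set [~ x, y]%g | x in @lower_central G m & y in [set: G]]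
  else [set: G].

Definition nilpotent_group (G : groupType) : Prop :=
  exists n : nat, @lower_central G n = [set 1%g].

Definition gdiff (G H : groupType) (h : G) (phi : G -> H) : G -> H :=
  fun g => ((phi g)^-1 * phi (g * h))%g.

Definition polynomial_map (G H : groupType) (phi : G -> H) : Prop :=
  exists d : nat, forall hs : d.+1.-tuple G,
    foldr (@gdiff G H) phi hs = fun=> 1%g.

Definition fset_symdiff (T : choiceType) (A B : {fset T}) : {fset T} :=
  ((A `\` B) `|` (B `\` A))%fset.

Definition left_folner (R : realType) (G : groupType)
    (F : nat -> {fset G}) : Prop :=
  (forall N, F N != fset0) /\
  forall g : G,
    (fun N => #|` fset_symdiff [fset (g * x)%g | x in F N]%fset (F N)|%:R
              / #|` F N|%:R : R) @ \oo --> (0 : R).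

Definition right_folner (R : realType) (G : groupType)
    (F : nat -> {fset G}) : Prop :=
  (forall N, F N != fset0) /\
  forall g : G,
    (fun N => #|` fset_symdiff [fset (x * g)%g | x in F N]%fset (F N)|%:R
              / #|` F N|%:R : R) @ \oo --> (0 : R).

Definition upper_density (R : realType) (G : groupType)
    (F : nat -> {fset G}) (E : set G) : R :=
  limn_sup (fun N => #|` [fset x in F N | x \in E]%fset|%:R
                     / #|` F N|%:R : R).

(* A countable nilpotent group is amenable, so there the supremum ranges over a
   nonempty subset of [0, 1]; the convention sup set0 = 0 plays no role. *)
Definition left_upper_banach_density (R : realType) (G : groupType)
    (A : set G) : R :=
  sup [set upper_density R F A | F in [set F | left_folner R F]].

(* Main.v *)
Require Import Defs.
From HB Require Import structures.
From mathcomp Require Import all_boot all_order all_algebra finmap.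
From mathcomp Require Import all_classical all_reals all_analysis.
From mathcomp Require Import zify ring lra.
Set Implicit Arguments.
Unset Strict Implicit.
Unset Printing Implicit Defensive.
Import Order.TTheory GRing.Theory Num.Theory.
Import numFieldNormedType.Exports.
Local Open Scope classical_set_scope.
Local Open Scope ring_scope.

(** Choose [x] in [H] and let [B] be the set of those [b] for which [p b * x] and
    [(q b)^-1 * x] both lie in [A].  Then [p b * q b'] is the quotient of
    [p b * x] by [(q b')^-1 * x], so [B] answers the question for one pair
    [(p, q)], provided that some [x] makes it large; for [s] pairs the same is done
    in the group [H ^ s], with independent points (lemma [controlled_cons]).  With
    respect to an invariant mean [mu], the set of [x] that are good for [b] has
    measure [mu (A :&: r b A)], where [r b = p b * q b] is again polynomial.  So two
    things are needed: the measure must be bounded below for a set of [b] of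
    positive upper density (recurrence), and one must pass from this to one [B]
    (lemma [intersectivity], which asks for a common [x] only for each pair of
    elements of [B]).

    Recurrence is obtained along an idempotent ultrafilter on [G], all of
    whose members have positive upper density along the given Folner sequence.
    Let [U] be the isometric action by translation on the Hilbert space completed
    from bounded functions.  The weak limit of the [U (r b)] along it is an
    orthogonal projection (theorem [polynomial_limit_isproj]), which fixes the
    constants; therefore [mu (A :&: r b A)] has a limit of at least
    [mu A ^ 2] (theorem [mean_recurrence]), and the [b] for which it is at least
    half of this form a member of the ultrafilter.

    The theorem on projections is proved by downward induction along a filtration
    of the acting group: at level [i] one shows for all based polynomial maps
    of that level that their limit operators are projections and that these
    commute.  For the first, [s (x y) = s y * s x * delta x y] with [delta x]
    of level [i + 1].  Let [Q] be the limit of the projections of the [delta x].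
    Where [Q] vanishes, so does the limit of [s], by a van der Corput argument;
    where [Q] is the identity, [s] is asymptotically an antihomomorphism, so that
    idempotence of the ultrafilter makes its limit idempotent.  Commutation is proved in the
    same way with the commutators of [s x] and [t y] in place of [delta].  That [Q]
    is itself a projection is where finite generation matters: limits of
    commuting projections are in general no projections, but here the maps whose
    projection fixes a given vector form a group of polynomial maps, and these
    groups satisfy the ascending chain condition, since a polynomial map is
    determined by its values at finitely many words and these values lie in a
    finitely generated nilpotent group. *)

(** * Polynomial maps into filtered groups *)

Section Filtration.
Local Open Scope group_scope.

Record filtration (Gam : groupType) (F : nat -> set Gam) : Prop := Filtration {
  fil1 : forall i, F i 1;
  filM : forall i x y, F i x -> F i y -> F i (x * y);
  filV : forall i x, F i x -> F i x^-1;
  filS : forall i x, F i.+1 x -> F i x;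
  filR : forall i j x y, F i x -> F j y -> F (i + j)%N [~ x, y] }.

Definition gsimp (Gam : groupType) :=
  (@invgM Gam, @invgK Gam, @invg1 Gam, @mulgA Gam, @mulgV Gam, @mulVg Gam,
   @mulg1 Gam, @mul1g Gam, @mulgK Gam, @mulgVK Gam).

Lemma conjgE' (Gam : groupType) (x y : Gam) : x ^ y = y^-1 * x * y.
Proof. by rewrite conjgE mulgA. Qed.

Lemma commgE' (Gam : groupType) (x y : Gam) : [~ x, y] = x^-1 * y^-1 * x * y.
Proof. by rewrite commgEl conjgE !mulgA. Qed.

End Filtration.

Ltac group_word :=
  rewrite ?commgE' ?conjgE' ?gsimp; try done.

Section Polynomials.
Local Open Scope group_scope.
Variables (T : Type) (op : T -> T -> T) (Gam : groupType) (F : nat -> set Gam).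
Hypothesis hF : filtration F.

Implicit Types s t : T -> Gam.

Definition der (x : T) s : T -> Gam := fun y => (s y)^-1 * s (op x y).

(** Depth [n] truncation of: all the [k]-th derivatives of [s] take their values
    in [F (i + k)].  The truncation makes inductions on the depth possible
    although the derivatives are not bounded in number. *)
Fixpoint poly_upto (n i : nat) s : Prop :=
  (forall y, F i (s y)) /\
  if n is n'.+1 then forall x, poly_upto n' i.+1 (der x s) else True.

Definition poly i s := forall n, poly_upto n i s.

Lemma poly_upto_val n i s : poly_upto n i s -> forall y, F i (s y).
Proof. by case: n => [|n] []. Qed.

Lemma poly_uptoW n i s : poly_upto n i.+1 s -> poly_upto n i s.
Proof.
elim: n i s => [|n IH] i s [sF ds]; split => //.
- by move=> y; exact: (filS hF).
- by move=> y; exact: (filS hF).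
- by move=> x; exact/IH/ds.
Qed.

Lemma poly_uptoWn n i j s : (i <= j)%N -> poly_upto n j s -> poly_upto n i s.
Proof.
move=> /subnK <-; elim: (j - i)%N => [//|k IH] h; apply: IH.
by apply: poly_uptoW; rewrite addSn in h.
Qed.

Lemma poly_uptoS n i s : poly_upto n.+1 i s -> poly_upto n i s.
Proof.
elim: n i s => [|n IH] i s [sF ds]; split => // x.
by apply: IH; exact: ds.
Qed.

Lemma poly_upto1 n i : poly_upto n i (fun=> 1).
Proof.
elim: n i => [|n IH] i; split => //.
- by move=> _; exact: fil1.
- by move=> _; exact: fil1.
- move=> x; suff -> : der x (fun=> 1) = fun=> 1 by exact: IH.
  by apply: funext => y; rewrite /der invg1 mulg1.
Qed.

Lemma poly_upto_const n i h : F i h -> poly_upto n i (fun=> h).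
Proof.
move=> Fh; case: n => [|n]; split => // x.
suff -> : der x (fun=> h) = fun=> 1 by exact: poly_upto1.
by apply: funext => y; rewrite /der mulVg.
Qed.

(** The derivative of a product, an inverse or a commutator is a product of
    derivatives, their conjugates and commutators, all of which sit one level
    deeper in the filtration; so the three closure properties are proved
    together by induction on the depth. *)
Lemma poly_upto_closed n :
  [/\ forall i s t, poly_upto n i s -> poly_upto n i t ->
        poly_upto n i (fun y => s y * t y),
      forall i s, poly_upto n i s -> poly_upto n i (fun y => (s y)^-1) &
      forall i j s t, poly_upto n i s -> poly_upto n j t ->
        poly_upto n (i + j) (fun y => [~ s y, t y])].
Proof.
elim: n => [|n [IM IV IR]].
  split=> [i s t [hs _] [ht _]|i s [hs _]|i j s t [hs _] [ht _]]; split => // y.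
  - exact: (filM hF).
  - exact: (filV hF).
  - exact: (filR hF).
have IJ i j s t : poly_upto n i s -> poly_upto n j t ->
    poly_upto n i (fun y => s y ^ t y).
  move=> hs ht.
  suff -> : (fun y => s y ^ t y) = fun y => s y * [~ s y, t y].
    by apply: IM => //; apply: poly_uptoWn (IR _ _ _ _ hs ht); exact: leq_addr.
  by apply: funext => y; group_word.
split.
- move=> i s t hs ht; have [Fs ds] := hs; have [Ft dt] := ht.
  split => [y|x]; first exact: (filM hF).
  have -> : der x (fun y => s y * t y) = fun y => der x s y ^ t y * der x t y.
    by apply: funext => y; rewrite /der; group_word.
  by apply: IM; [apply: (IJ _ i); [exact: ds | exact: poly_uptoS] | exact: dt].
- move=> i s hs; have [Fs ds] := hs; split => [y|x]; first exact: (filV hF).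
  have -> : der x (fun y => (s y)^-1) = fun y => (der x s y)^-1 ^ (s y)^-1.
    by apply: funext => y; rewrite /der; group_word.
  by apply: (IJ _ i); [exact/IV/ds | exact/IV/poly_uptoS].
- move=> i j s t hs ht; have [Fs ds] := hs; have [Ft dt] := ht.
  split => [y|x]; first exact: (filR hF).
  pose a := der x s; pose b := der x t; pose c y := [~ s y, t y].
  have -> : der x (fun y => [~ s y, t y]) = fun y =>
      ([~ s y, b y] ^ a y) ^ c y * [~ c y, b y * a y] *
      [~ a y, b y] * ([~ a y, t y] ^ b y).
    by apply: funext => y; rewrite /c /a /b /der; group_word.
  have [hs' ht'] := (poly_uptoS hs, poly_uptoS ht).
  have ha : poly_upto n i.+1 a by exact: ds.
  have hb : poly_upto n j.+1 b by exact: dt.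
  have hc : poly_upto n (i + j) c by exact: IR.
  apply: (IM (i + j).+1); first apply: (IM (i + j).+1);
    first apply: (IM (i + j).+1).
  + apply: (IJ _ (i + j)%N) hc; apply: (IJ _ i.+1) ha.
    by rewrite -addnS; exact: IR.
  + rewrite -addn1; apply: IR => //.
    by apply: IM; [apply: poly_uptoWn hb | apply: poly_uptoWn ha].
  + by apply: (poly_uptoWn _ (IR _ _ _ _ ha hb)); rewrite addSn addnS leqnSn.
  + by apply: (IJ _ j.+1) hb; rewrite -addSn; exact: IR.
Qed.

Lemma poly_val i s : poly i s -> forall y, F i (s y).
Proof. by move=> /(_ 0)/poly_upto_val. Qed.

Lemma poly_der i s x : poly i s -> poly i.+1 (der x s).
Proof. by move=> hs n; case: (hs n.+1) => _; exact. Qed.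

Lemma polyM i s t : poly i s -> poly i t -> poly i (fun y => s y * t y).
Proof. by move=> hs ht n; case: (poly_upto_closed n) => + _ _; apply. Qed.

Lemma polyV i s : poly i s -> poly i (fun y => (s y)^-1).
Proof. by move=> hs n; case: (poly_upto_closed n) => _ + _; apply. Qed.

Lemma polyR i j s t : poly i s -> poly j t -> poly (i + j) (fun y => [~ s y, t y]).
Proof. by move=> hs ht n; case: (poly_upto_closed n) => _ _; apply. Qed.

Lemma polyW i j s : (i <= j)%N -> poly j s -> poly i s.
Proof. by move=> ij hs n; exact: poly_uptoWn (hs n). Qed.

Lemma poly1 i : poly i (fun=> 1).
Proof. by move=> n; exact: poly_upto1. Qed.

Lemma poly_const i h : F i h -> poly i (fun=> h).
Proof. by move=> Fh n; exact: poly_upto_const. Qed.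

End Polynomials.

(** * Independence of the side of translation *)

Section TwoSided.
Local Open Scope group_scope.
Variables (T : Type) (op op' : T -> T -> T) (one : T).
Variables (Gam : groupType) (F : nat -> set Gam).
Hypothesis hF : filtration F.
Hypothesis opC : forall x y z, op x (op' y z) = op' y (op x z).
Hypothesis op1 : forall x, op x one = x.

(** With [d] the derivative of [s] along [op] in the direction [k] and [l] the
    derivative of [s] along [op'] in the direction [h], the derivative of [l]
    along [op] is [[~ l, d]] times the [op']-derivative of [d].  So the depth to
    which [l] is known to be polynomial can be improved by one. *)
Lemma poly_der_comm i (s : T -> Gam) h :
  poly op F i s -> poly op F i.+1 (der op' h s).
Proof.
move=> hs n; elim: n i s hs => [|n IH] i s hs.
  split => // y.
  have -> : der op' h s y = (der op y s one)^-1 * der op (op' h y) s one.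
    by rewrite /der !op1; group_word.
  by apply: (filM hF); [apply: (filV hF)|]; apply: (poly_val (poly_der _ hs)).
split => [|k]; first exact: poly_upto_val (IH _ _ hs).
have -> : der op k (der op' h s) =
    fun y => [~ der op' h s y, der op k s y] * der op' h (der op k s) y.
  by apply: funext => y; rewrite /der opC; group_word.
have [IM _ IR] := poly_upto_closed op hF n.
apply: IM; last exact/IH/poly_der.
apply: (poly_uptoWn hF _ (IR _ _ _ _ (IH _ _ hs) (poly_der k hs n))).
by rewrite addSn !ltnS addnS ltnS leq_addr.
Qed.

Lemma poly_comm i (s : T -> Gam) : poly op F i s -> poly op' F i s.
Proof.
move=> hs n; elim: n i s hs => [|n IH] i s hs.
  by split => //; exact: poly_val hs.
split; first exact: poly_val hs.
by move=> h; apply: IH; exact: poly_der_comm.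
Qed.

End TwoSided.

(** * The filtration of a nilpotent group *)

Section LowerCentral.
Local Open Scope group_scope.
Variable Gam : groupType.
Implicit Types (x y z : Gam) (S K : set Gam).

Definition subgroup K :=
  [/\ K 1, forall x y, K x -> K y -> K (x * y) & forall x, K x -> K x^-1].

Lemma subgroup_closed K : subgroup K -> group_closed (mem K).
Proof.
move=> [K1 KM KV]; split; first exact/mem_set.
by move=> x y /set_mem Kx /set_mem Ky; apply/mem_set/KM => //; apply: KV.
Qed.

Lemma closed_subgroup K : group_closed (mem K) -> subgroup K.
Proof.
move=> Kc; split; first by case: Kc => /set_mem.
- move=> x y Kx Ky; apply/set_mem.
  by apply: (group_closedM Kc); exact/mem_set.
- by move=> x Kx; apply/set_mem; apply: (group_closedV Kc); exact/mem_set.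
Qed.

Lemma generated_subgroup S : subgroup (generated S).
Proof.
split.
- by move=> K [/closed_subgroup[]].
- move=> x y hx hy K KS; have [/closed_subgroup[_ KM _] _] := KS.
  by apply: KM; [apply: hx | apply: hy].
- move=> x hx K KS; have [/closed_subgroup[_ _ KV] _] := KS.
  by apply: KV; apply: hx.
Qed.

Lemma sub_generated S : S `<=` generated S.
Proof. by move=> x Sx K [_]; apply. Qed.

Lemma generated_min S K : subgroup K -> S `<=` K -> generated S `<=` K.
Proof. by move=> /subgroup_closed Kc SK x; apply. Qed.

Definition conj_stable K := forall x z, K x -> K (x ^ z).

Lemma generated_normal S :
  (forall x z, S x -> generated S (x ^ z)) -> conj_stable (generated S).
Proof.
move=> hS x z hx.
have [g1 gM gV] := generated_subgroup S.
have : generated S `<=` [set x | generated S (x ^ z)].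
  apply: generated_min => [|y Sy /=]; last exact: hS.
  split=> [|u v /= hu hv|u /= hu]; rewrite /= ?conj1g ?conjMg ?conjVg //.
  - exact: gM.
  - exact: gV.
by apply.
Qed.

Local Arguments lower_central : simpl never.
Notation lc := (@lower_central Gam).

Lemma lc_subgroup n : subgroup (lc n).
Proof. by case: n => [|n] //; exact: generated_subgroup. Qed.

Lemma lc_normal n : conj_stable (lc n).
Proof.
elim: n => [//|n IH]; apply: generated_normal => _ z [x lx [y _ <-]].
rewrite conjRg; apply: sub_generated; exists (x ^ z); first exact: IH.
by exists (y ^ z).
Qed.

Lemma lc_commT n x y : lc n x -> lc n.+1 [~ x, y].
Proof. by move=> lx; apply: sub_generated; exists x => //; exists y. Qed.

Lemma lcS n x : lc n.+1 x -> lc n x.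
Proof.
have [l1 lM lV] := lc_subgroup n.
apply: generated_min => // _ [u lu [v _ <-]].
by rewrite commgEl; apply: lM; [apply: lV|apply: lc_normal].
Qed.

Lemma lcW m n x : (m <= n)%N -> lc n x -> lc m x.
Proof.
move=> /subnK <-; elim: (n - m)%N => [//|k IH]; rewrite addSn => /lcS.
exact: IH.
Qed.

Lemma hall_witt x y z :
  [~ [~ x, y^-1], z] ^ y * [~ [~ y, z^-1], x] ^ z * [~ [~ z, x^-1], y] ^ x = 1.
Proof. by group_word. Qed.

(** The inductive step is the three subgroups lemma. *)
Lemma lc_comm a b x y : lc a x -> lc b y -> lc (a + b).+1 [~ x, y].
Proof.
elim: b a x y => [|b IH] a x y lx ly; first by rewrite addn0; exact: lc_commT.
have [n1 nM nV] := lc_subgroup (a + b.+1).+1.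
suff : lc b.+1 `<=` [set y | forall x, lc a x -> lc (a + b.+1).+1 [~ x, y]].
  by move=> /(_ y ly); apply.
apply: generated_min.
  split=> [u _|u v hu hv w lw|u hu w lw] /=; rewrite /= ?commg1 //.
  - have -> : [~ w, u * v] = [~ w, v] * [~ w, u] ^ v by group_word.
    by apply: nM; [exact: hv|apply: lc_normal; exact: hu].
  - have -> : [~ w, u^-1] = ([~ w, u]^-1) ^ u^-1 by group_word.
    by apply: lc_normal; apply: nV; exact: hu.
move=> _ [u lu [v _ <-]] w lw.
suff h : lc (a + b.+1).+1 [~ [~ u, v], w] by rewrite -invgR; exact: nV.
have hw := hall_witt w u v^-1; rewrite invgK in hw.
have -> : [~ [~ u, v], w] = (([~ [~ w, u^-1], v^-1] ^ u)^-1 *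
    ([~ [~ v^-1, w^-1], u] ^ w)^-1) ^ v.
  set A := _ ^ u in hw *; set B := _ ^ v^-1 in hw; set C := _ ^ w in hw *.
  have -> : [~ [~ u, v], w] = B ^ v by rewrite /B; group_word.
  have hB : A * B = C^-1 by apply/eqP; rewrite -divg_eq1 invgK hw.
  by rewrite -hB mulKg.
have lV k t : lc k t -> lc k t^-1 by have [_ _ h] := lc_subgroup k; exact: h.
apply: lc_normal; apply: nM; apply: nV; apply: lc_normal.
- by rewrite addnS; apply: lc_commT; apply: IH => //; exact: lV lu.
- rewrite -addSnnS; apply: IH => //.
  by rewrite -invgR; apply: (lV); apply: lc_commT; exact: lV lw.
Qed.

(** Spacing the lower central series by [D] makes room for maps whose degree in
    the abelianization is up to [D]. *)
Definition lcfil D (i : nat) : set Gam := lc (i.-1 %/ D).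

Lemma lcfil_filtration D : (0 < D)%N -> filtration (lcfil D).
Proof.
move=> D0; split.
- by move=> i; have [] := lc_subgroup (i.-1 %/ D).
- by move=> i; have [] := lc_subgroup (i.-1 %/ D).
- by move=> i; have [] := lc_subgroup (i.-1 %/ D).
- by move=> i x; apply: lcW; apply: leq_div2r; rewrite -pred_Sn leq_pred.
move=> i j x y hx hy; apply: lcW (lc_comm hx hy).
have hi := divn_eq i.-1 D; have hj := divn_eq j.-1 D.
have ri := ltn_pmod i.-1 D0; have rj := ltn_pmod j.-1 D0.
rewrite -ltnS ltn_divLR //.
by move: hi hj ri rj; rewrite ?mulSn ?mulnDl; lia.
Qed.

Lemma lcfil_small D i : (i <= D)%N -> lcfil D i = setT.
Proof.
rewrite /lcfil => iD; rewrite (_ : i.-1 %/ D = 0)%N //.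
by case: i iD => [|i] iD; [rewrite div0n | rewrite divn_small].
Qed.

Lemma lcfil_trivial D : (0 < D)%N -> nilpotent_group Gam ->
  exists m, forall i, (m <= i)%N -> lcfil D i `<=` [set 1].
Proof.
move=> D0 [n hn]; exists (n * D).+1 => i mi x hx; rewrite -hn.
by apply: lcW hx; rewrite leq_divRL //; lia.
Qed.

End LowerCentral.

Section PlainPolynomial.
Local Open Scope group_scope.
Variables (G Gam : groupType).

Notation opr := (fun x y : G => y * x).

(** A map with vanishing derivatives of order [D] respects [lcfil D] for want of
    anything to check: its derivatives of order at most [D] may take any value, and
    the later ones are trivial. *)
Lemma polynomial_map_poly (phi : G -> Gam) : polynomial_map phi ->
  exists d, forall D, (d < D)%N -> poly opr (@lcfil Gam D) 0 phi.
Proof.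
move=> [d hd]; exists d => D dD n.
pose tot k (s : G -> Gam) := forall hs : seq G, size hs = k ->
  foldr (@gdiff G Gam) s hs = fun=> 1.
have : tot d.+1 phi by move=> hs /eqP shs; exact: (hd (Tuple shs)).
have hF : filtration (@lcfil Gam D) by apply: lcfil_filtration; lia.
have : (d.+1 + 0 <= D)%N by lia.
elim: n d.+1 0%N phi {hd dD} => [|n IH] k i s kD hs.
  by split => // y; rewrite lcfil_small //; lia.
split => [y|h]; first by rewrite lcfil_small //; lia.
case: k kD hs => [|k] kD hs.
  have -> : s = fun=> 1 by exact: (hs [::]).
  have [_] := poly_upto1 opr hF n.+1 i; exact.
apply: (IH k); first by lia.
by move=> l sl; have := hs (rcons l h); rewrite foldr_rcons size_rcons sl; apply.
Qed.

End PlainPolynomial.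

(** * Finitely generated nilpotent groups and the ascending chain condition *)

Section Polycyclic.
Local Open Scope group_scope.
Variables (Gam : groupType) (X : seq Gam).

Definition gen (l : seq Gam) : set Gam := generated [set x | x \in l].

Lemma gen_subgroup l : subgroup (gen l).
Proof. exact: generated_subgroup. Qed.

Lemma mem_gen l x : x \in l -> gen l x.
Proof. by move=> xl; apply: sub_generated. Qed.

Lemma gen_sub l l' : (forall x, x \in l -> gen l' x) -> gen l `<=` gen l'.
Proof. by move=> h; apply: generated_min => //; exact: gen_subgroup. Qed.

Lemma gen_nil : gen [::] `<=` [set 1].
Proof.
apply: generated_min => //.
by split=> [//|x y /= -> ->|x /= ->]; rewrite /= ?mulg1 ?invg1.
Qed.

Lemma gen_cons w l : gen l `<=` gen (w :: l).
Proof. by apply: gen_sub => x xl; apply: mem_gen; rewrite in_cons xl orbT. Qed.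

(** The last terms of the list generate a central series of the group generated
    by [X]. *)
Fixpoint central_list (l : seq Gam) : Prop :=
  if l is w :: l' then
    (forall x, x \in X -> gen l' [~ w, x]) /\ central_list l'
  else True.

Lemma central_normal l : central_list l ->
  forall c g, gen l c -> gen X g -> gen l (c ^ g).
Proof.
move=> cl; suff h x : x \in X -> forall c, gen l c ->
    gen l (c ^ x) /\ gen l (c ^ x^-1).
  move=> c g lc lg; move: g lg c lc.
  pose N := [set g | forall c, gen l c -> gen l (c ^ g) /\ gen l (c ^ g^-1)].
  suff : gen X `<=` N by move=> XN g /XN gN c /gN[].
  apply: generated_min => [|x xX]; last by move=> c; exact: h.
  split=> [c lc|g k hg hk c lc|g hg c /hg[]] /=.
  - by rewrite invg1 conjg1.
  - rewrite invgM !conjgM; split; first by have [/hk[]] := hg _ lc.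
    by have [_ /hg[]] := hk _ lc.
  - by rewrite invgK; split.
move=> xX; elim: l cl => [_ c /gen_nil ->|w l IH [cw /IH{}IH] c].
  by rewrite !conj1g; split; have [] := gen_subgroup [::].
have [g1 gM gV] := gen_subgroup (w :: l).
have wl : gen (w :: l) w by apply: mem_gen; rewrite mem_head.
have := @generated_min _ _ [set c | gen (w :: l) (c ^ x) /\
  gen (w :: l) (c ^ x^-1)]; apply.
  split=> [|a b [a1 a2] [b1 b2]|a [a1 a2]]; rewrite /= ?conj1g ?conjMg ?conjVg.
  - by split.
  - by split; apply: gM.
  - by split; apply: gV.
move=> u /=; rewrite in_cons => /predU1P[->|ul].
  have hu := cw x xX; split.
    have -> : w ^ x = w * [~ w, x] by group_word.
    by apply: gM => //; exact: gen_cons.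
  have -> : w ^ x^-1 = w * ([~ w, x] ^ x^-1)^-1 by group_word.
  by apply: gM => //; apply: gV; apply: gen_cons; case: (IH _ hu).
by have [] := IH _ (mem_gen ul); split; exact: gen_cons.
Qed.

(** The two cases stand for the sign of an integral exponent. *)
Lemma gen_cons_expg w l : (forall c, gen l c -> gen l (c ^ w)) ->
  (forall c, gen l c -> gen l (c ^ w^-1)) ->
  forall y, gen (w :: l) y ->
  exists n : nat, gen l ((w ^+ n)^-1 * y) \/ gen l (w ^+ n * y).
Proof.
move=> n1 n2; have [g1 gM gV] := gen_subgroup l.
have n1' k c : gen l c -> gen l (c ^ (w ^+ k)).
  by elim: k c => [|k IH] c lc; rewrite ?expg0 ?conjg1 // expgS conjgM; exact: IH (n1 _ lc).
have n2' k c : gen l c -> gen l (c ^ (w ^+ k)^-1).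
  elim: k c => [|k IH] c lc; first by rewrite expg0 invg1 conjg1.
  by rewrite expgSr invgM conjgM; exact: IH (n2 _ lc).
(* An integral exponent is represented by the difference [b - a], which makes the
   closure under products and inverses uniform. *)
pose Y := [set y | exists a b : nat, gen l ((w ^+ b)^-1 * (w ^+ a * y))].
suff : gen (w :: l) `<=` Y.
  move=> h y /h[a [b hab]]; have [ab|/ltnW ba] := leqP a b.
    exists (b - a)%N; left; move: hab.
    by rewrite -{1}(subnKC ab) expgnDr; group_word.
  exists (a - b)%N; right; move: hab.
  by rewrite -{1}(subnKC ba) expgnDr; group_word.
have wC a b : w ^+ a * w ^+ b = w ^+ b * w ^+ a by rewrite -!expgnDr addnC.
apply: generated_min => [|u /=]; last first.
  rewrite in_cons => /predU1P[->|ul].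
    by exists 0%N, 1%N; rewrite expg0 expg1 mul1g mulVg.
  by exists 0%N, 0%N; rewrite expg0 invg1 !mul1g; exact: mem_gen.
split=> [|y z [a [b h]] [a' [b' h']]|y [a [b h]]].
- by exists 0%N, 0%N; rewrite expg0 invg1 !mul1g.
- exists (a + a')%N, (b + b')%N.
  have -> : (w ^+ (b + b'))^-1 * (w ^+ (a + a') * (y * z)) =
     ((((w ^+ b)^-1 * (w ^+ a * y)) ^ (w ^+ a')^-1) ^ (w ^+ b')) *
       ((w ^+ b')^-1 * (w ^+ a' * z)).
    have wV : (w ^+ b)^-1 * w ^+ a' = w ^+ a' * (w ^+ b)^-1.
      by apply: (mulgI (w ^+ b)); rewrite mulVKg mulgA wC mulgK.
    rewrite [(a + a')%N]addnC !expgnDr; group_word.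
    by do 3 congr (_ * _); rewrite -!mulgA wV.
  by apply: gM => //; apply: n1'; apply: n2'.
exists b, a.
have -> : (w ^+ a)^-1 * (w ^+ b * y^-1) =
    (((w ^+ b)^-1 * (w ^+ a * y))^-1 ^ (w ^+ b)^-1) ^ (w ^+ a).
  by group_word.
by apply: n1'; apply: n2'; apply: gV.
Qed.

(** [W] holds the left-normed commutators of the current length. *)
Fixpoint commutator_list k (W : seq Gam) : seq Gam :=
  if k is k'.+1 then
    W ++ commutator_list k' [seq [~ w, x] | w <- W, x <- X]
  else [::].

Lemma central_list_cat W l : central_list l ->
  (forall w x, w \in W -> x \in X -> gen l [~ w, x]) -> central_list (W ++ l).
Proof.
move=> cl; elim: W => [//|w W IH] h; split; last first.
  by apply: IH => u x uW; apply: h; rewrite in_cons uW orbT.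
move=> x xX; have : gen l [~ w, x] by apply: h => //; rewrite mem_head.
by apply: gen_sub => u ul; apply: mem_gen; rewrite mem_cat ul orbT.
Qed.

Variables (F : nat -> set Gam) (m : nat).
Hypothesis hF : filtration F.
Hypothesis Fm : forall i, (m <= i)%N -> F i `<=` [set 1].
Hypothesis FX : forall x, x \in X -> F 1%N x.

Lemma commutator_list_central k j W : (m <= j + k)%N ->
  (forall w, w \in W -> F j w) -> central_list (commutator_list k W).
Proof.
elim: k j W => [//|k IH] j W mjk FW.
have FC w : w \in [seq [~ w, x] | w <- W, x <- X] -> F j.+1 w.
  case/allpairsP => -[u x] /= [uW xX ->]; rewrite -addn1.
  by apply: (filR hF); [exact: FW | exact: FX].
apply: central_list_cat => [|w x wW xX].
  by apply: (IH j.+1) => //; rewrite addSnnS.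
have wx : [~ w, x] \in [seq [~ w, x] | w <- W, x <- X].
  by apply/allpairsP; exists (w, x).
case: k {IH} mjk => [|k] mjk /=.
  have -> : [~ w, x] = 1 by apply: (Fm _ (FC _ wx)); rewrite -addn1.
  by have [] := gen_subgroup [::].
by apply: mem_gen; rewrite mem_cat wx.
Qed.

Lemma gen_commutator_list k W :
  (forall w, w \in W -> gen X w) ->
  forall w, w \in commutator_list k W -> gen X w.
Proof.
have [g1 gM gV] := gen_subgroup X.
elim: k W => [//|k IH] W hW w; rewrite mem_cat => /orP[/hW//|]; apply: IH => u.
case/allpairsP => -[v x] /= [/hW hv /mem_gen hx ->].
by rewrite commgEl conjgE; do ?[apply: (gM) | apply: (gV)].
Qed.

(** The commutator of a listed element with a generator is listed further on,
    or trivial once the length exceeds the class: this is the polycyclic series of a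
    finitely generated nilpotent group. *)
Lemma polycyclic_list : exists l, [/\ central_list l, gen l = gen X &
  forall w, w \in l -> gen X w].
Proof.
exists (commutator_list m.+1 X).
have h w : w \in commutator_list m.+1 X -> gen X w.
  by apply: gen_commutator_list; exact: mem_gen.
split => //.
  by apply: (@commutator_list_central _ 1) => //; rewrite addnC; lia.
apply/seteqP; split; first exact: gen_sub.
by apply: gen_sub => x xX; apply: mem_gen; rewrite mem_cat xX.
Qed.

End Polycyclic.

(** The nonnegative parts of an increasing sequence of subgroups of Z become
    stationary once the least positive element of their union has appeared. *)
Lemma nat_subgroups_stable (I : nat -> set nat) :
  (forall n a, I n a -> I n.+1 a) ->
  (forall n a b, I n a -> I n b -> (a <= b)%N -> I n (b - a)%N) ->
  (forall n a k, I n a -> I n (k * a)%N) -> (forall n, I n 0%N) ->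
  exists N, forall n a, I n a -> I N a.
Proof.
move=> IS IB IX I0.
have IW n n' a : (n <= n')%N -> I n a -> I n' a.
  move=> /subnK <-; elim: (n' - n)%N => [//|k IH] /IH; rewrite addSn; exact: IS.
have [[n0 [a0 [a00 Ia0]]]|none] := pselect (exists n a, (0 < a)%N /\ I n a);
    last first.
  exists 0%N => n [|a] Ina //.
  by exfalso; apply: none; exists n, a.+1.
pose P := fun a => `[< (0 < a)%N /\ exists n, I n a >].
have exP : exists a, P a by exists a0; apply/asboolP; split => //; exists n0.
case: (ex_minnP exP) => d /asboolP[d0 [N INd]] dmin; exists N => n a Ina.
suff ad : (d %| a)%N by rewrite -(divnK ad); exact: IX.
have [//|nd] := boolP (d %| a)%N; exfalso.
pose M := maxn n N.
have IMd : I M d by apply: IW INd; exact: leq_maxr.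
have IMa : I M a by apply: IW Ina; exact: leq_maxl.
have IMr : I M (a %% d)%N.
  rewrite modn_def; case: edivnP => q r {nd} e _ /=.
  rewrite -(addKn (q * d) r) -e; apply: IB => //; first exact: IX.
  by rewrite e leq_addr.
have : (d <= a %% d)%N.
  by apply: dmin; apply/asboolP; split; [rewrite lt0n | exists M].
by rewrite leqNgt ltn_pmod.
Qed.

Section Chain.
Local Open Scope group_scope.
Variables (T : eqType) (Gam : groupType) (X : seq Gam).
Variable L : nat -> set (T -> Gam).
Hypothesis LS : forall n s, L n s -> L n.+1 s.
Hypothesis L1 : forall n, L n (fun=> 1).
Hypothesis LD : forall n s t, L n s -> L n t -> L n (fun y => (s y)^-1 * t y).

Let LW n n' s : (n <= n')%N -> L n s -> L n' s.
Proof.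
move=> /subnK <-; elim: (n' - n)%N => [//|k IH] /IH; rewrite addSn; exact: LS.
Qed.

Let LV n s : L n s -> L n (fun y => (s y)^-1).
Proof.
move=> Ls; have -> : (fun y => (s y)^-1) = fun y => (s y)^-1 * 1.
  by apply: funext => y; rewrite mulg1.
exact: (LD Ls (L1 n)).
Qed.

Let LM n s t : L n s -> L n t -> L n (fun y => s y * t y).
Proof.
move=> Ls Lt; have -> : (fun y => s y * t y) = fun y => (s y)^-1^-1 * t y.
  by apply: funext => y; rewrite invgK.
exact: (LD (LV Ls) Lt).
Qed.

Definition stationary (Z : set (T -> Gam)) :=
  exists N, forall n s, L n s -> Z s -> L N s.

(** The exponents of [w] that occur at [g] modulo [gen l] form a subgroup of Z,
    so they stabilise; two functions with the same exponent differ by one whose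
    value at [g] lies in [gen l]. *)
Lemma stable_coord (Z : set (T -> Gam)) (g : T) :
  Z (fun=> 1) -> (forall s t, Z s -> Z t -> Z (fun y => (s y)^-1 * t y)) ->
  stationary [set s | Z s /\ s g = 1] ->
  forall l, central_list X l -> (forall w, w \in l -> gen X w) ->
  stationary [set s | Z s /\ gen l (s g)].
Proof.
move=> Z1 ZD st1.
have ZV s : Z s -> Z (fun y => (s y)^-1).
  move=> Zs; have -> : (fun y => (s y)^-1) = fun y => (s y)^-1 * 1.
    by apply: funext => y; rewrite mulg1.
  exact: (ZD _ _ Zs Z1).
have ZM s t : Z s -> Z t -> Z (fun y => s y * t y).
  move=> Zs Zt; have -> : (fun y => s y * t y) = fun y => (s y)^-1^-1 * t y.
    by apply: funext => y; rewrite invgK.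
  exact: (ZD _ _ (ZV _ Zs) Zt).
elim=> [_ _|w l IH [cw cl] lX].
  have [N hN] := st1; exists N => n s Ls [Zs /gen_nil sg].
  exact: (hN n).
have [|N1 hN1] := IH cl.
  by move=> u ul; apply: lX; rewrite in_cons ul orbT.
have Xw : gen X w by apply: lX; rewrite mem_head.
have [g1 gM gV] := gen_subgroup l.
have [X1 XM XV] := gen_subgroup X.
have nrm c h : gen l c -> gen X h -> gen l (c ^ h) by exact: central_normal.
have Xwn k : gen X (w ^+ k).
  by elim: k => [|k IHk]; [rewrite expg0 | rewrite expgS; exact: XM].
pose I n := [set a | exists s, [/\ L n s, Z s & gen l ((w ^+ a)^-1 * s g)]].
have ID n a b : I n a -> I n b -> I n (a + b)%N.
  move=> [s [Ls Zs sg]] [t [Lt Zt tg]].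
  exists (fun y => s y * t y); split; [exact: LM|exact: ZM|].
  have -> : (w ^+ (a + b))^-1 * (s g * t g) =
     ((w ^+ a)^-1 * s g) ^ (w ^+ b) * ((w ^+ b)^-1 * t g).
    by rewrite expgnDr; group_word.
  by apply: gM => //; exact: nrm.
have I0 n : I n 0%N.
  by exists (fun=> 1); split => //; rewrite expg0 mulg1 invg1.
have [||||N2 hN2] := @nat_subgroups_stable I.
- by move=> n a [s [Ls Zs sg]]; exists s; split => //; exact: LS.
- move=> n a b [s [Ls Zs sg]] [t [Lt Zt tg]] ab.
  exists (fun y => (s y)^-1 * t y); split; [exact: LD|exact: ZD|].
  have -> : (w ^+ (b - a))^-1 * ((s g)^-1 * t g) =
     ((w ^+ a)^-1 * s g)^-1 ^ (w ^+ (b - a)) * ((w ^+ b)^-1 * t g).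
    by rewrite -{3}(subnKC ab) expgnDr; group_word.
  by apply: gM => //; apply: nrm => //; exact: gV.
- move=> n a k Ia; elim: k => [|k IHk]; first by rewrite mul0n.
  by rewrite mulSn; exact: ID.
- exact: I0.
pose N := maxn N1 N2.
have main n s a : L n s -> Z s -> gen l ((w ^+ a)^-1 * s g) -> L N s.
  move=> Ls Zs sg.
  have [|s' [Ls' Zs' sg']] := hN2 n a; first by exists s.
  pose t y := (s' y)^-1 * s y.
  have -> : s = fun y => s' y * t y by apply: funext => y; rewrite /t mulVKg.
  apply: LM; first by apply: (LW _ Ls'); exact: leq_maxr.
  apply: (@LW N1); first exact: leq_maxl.
  apply: (hN1 (maxn n N2)); last split; last 1 first.
  - have -> : t g = ((w ^+ a)^-1 * s' g)^-1 * ((w ^+ a)^-1 * s g).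
      by rewrite /t; group_word.
    by apply: gM => //; exact: gV.
  - by apply: LD; [apply: (LW _ Ls'); exact: leq_maxr
                  |apply: (LW _ Ls); exact: leq_maxl].
  - exact: ZD.
exists N => n s Ls [Zs sg].
have [||a [ha|ha]] := @gen_cons_expg _ w l _ _ (s g) sg.
- by move=> c lc; exact: nrm.
- by move=> c lc; apply: nrm => //; exact: XV.
- exact: (main n s a Ls Zs ha).
- have -> : s = fun y => (s y)^-1^-1 by apply: funext => y; rewrite invgK.
  apply: LV; apply: (main n _ a); [exact: LV|exact: ZV|].
  have -> : (w ^+ a)^-1 * (s g)^-1 = (w ^+ a * s g)^-1 ^ (w ^+ a) by group_word.
  by apply: nrm => //; exact: gV.
Qed.

Variables (W : seq T) (l : seq Gam).
Hypothesis hl : central_list X l.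
Hypothesis lX : forall w, w \in l -> gen X w.
Hypothesis Ll : forall n s, L n s -> forall y, gen l (s y).
Hypothesis LW1 : forall n s, L n s -> (forall y, y \in W -> s y = 1) ->
  s = fun=> 1.

(** The points of [W] are released one by one, starting from the functions that
    are trivial on all of [W]; each release is an instance of [stable_coord]. *)
Lemma chain_stable : exists N, forall n s, L n s -> L N s.
Proof.
suff h (V : seq T) : stationary [set s | forall y, y \in V -> s y = 1] -> stationary setT.
  have [|N hN] := h W; last by exists N => n s Ls; exact: (hN n).
  by exists 0%N => n s Ls /(LW1 Ls) ->; exact: L1.
elim: V => [|v V IH] hV.
  by have [N hN] := hV; exists N => n s Ls _; exact: (hN n).
apply: IH; pose Z := [set s : T -> Gam | forall y, y \in V -> s y = 1].
have [//|||N hN] := @stable_coord Z v _ _ _ l hl lX.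
- by move=> s t Zs Zt y yV; rewrite Zs // Zt // invg1 mulg1.
- have [N hN] := hV; exists N => n s Ls [Zs sv]; apply: (hN n) => //.
  by move=> y; rewrite in_cons => /predU1P[->//|]; exact: Zs.
by exists N => n s Ls Zs; apply: (hN n) => //; split => //; exact: (Ll Ls).
Qed.

End Chain.

(** * Polynomial maps on a finitely generated domain *)

Section Determined.
Local Open Scope group_scope.
Variables (T : eqType) (op : T -> T -> T) (one : T) (X : seq T).
Hypothesis genX : forall P : set T, P one ->
  (forall x y, x \in X -> P y -> P (op x y)) -> forall y, P y.
Variables (Gam : groupType) (F : nat -> set Gam) (m : nat).
Hypothesis Fm : forall i, (m <= i)%N -> F i `<=` [set 1].

Fixpoint words n : seq T :=
  if n is n'.+1 then one :: [seq op x y | x <- X, y <- words n'] else [::].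

Lemma words_op n x y : x \in X -> y \in words n -> op x y \in words n.+1.
Proof.
by move=> xX yw; rewrite /= in_cons; apply/orP; right; apply/allpairsP; exists (x, y).
Qed.

Lemma wordsS n y : y \in words n -> y \in words n.+1.
Proof.
elim: n y => [//|n IH] y; rewrite [words n.+1]/= in_cons => /orP[/eqP ->|].
  by rewrite mem_head.
by case/allpairsP => -[u v] [/= uX vw ->]; exact: (words_op uX (IH _ vw)).
Qed.

(** Along words, [s (op x y) = s y * der op x s y], and the derivative is
    controlled by shorter words and a deeper level. *)
Lemma poly_gen n i (s : T -> Gam) K : subgroup K -> poly op F i s ->
  (m <= i + n)%N -> (forall y, y \in words n -> K (s y)) -> forall y, K (s y).
Proof.
move=> [K1 KM KV]; elim: n i s => [|n IH] i s hs mi hK.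
  by move=> y; rewrite (Fm _ (poly_val hs y)) // -[i]addn0.
apply: genX => [|x y xX Ky]; first by apply: hK; rewrite mem_head.
have -> : s (op x y) = s y * der op x s y by rewrite /der mulVKg.
apply: (KM) => //; apply: (IH i.+1) => [||z zw]; first exact: poly_der.
  by rewrite addSnnS.
by apply: (KM); [apply: KV; apply/hK/wordsS | apply/hK/words_op].
Qed.

Lemma poly_determined i (s : T -> Gam) : poly op F i s ->
  (forall y, y \in words m -> s y = 1) -> s = fun=> 1.
Proof.
move=> hs h; apply: funext; apply: (@poly_gen m i s [set 1]) => //.
  by split=> [//|x y /= -> ->|x /= ->]; rewrite /= ?mulg1 ?invg1.
exact: leq_addl.
Qed.

End Determined.

(** * Idempotent ultrafilters *)

Section Idempotent.
Variables (T : Type) (op : T -> T -> T).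
Hypothesis opA : associative op.

(** The filter of iterated limits, which for ultrafilters is the product of the
    Stone-Cech compactification. *)
Definition fprod (F G : set_system T) : set_system T :=
  [set X | F [set x | G [set y | X (op x y)]]].

Definition subidempotent (F : set_system T) :=
  ProperFilter F /\ F `<=` fprod F F.

Lemma fprod_filter F G : ProperFilter F -> ProperFilter G ->
  ProperFilter (fprod F G).
Proof.
move=> FF GG; apply: Build_ProperFilter_ex.
  move=> X; rewrite /fprod /= => /filter_ex[x /filter_ex[y Xy]].
  by exists (op x y).
split; rewrite /fprod /=.
- by apply: (@filterS _ F _ setT) filterT => x _ /=; exact: filterT.
- by move=> X Y FX FY; apply: (@filterS2 _ F) FX FY => x /=; exact: filterI.
- by move=> X Y XY; apply: (@filterS _ F) => x /=; apply: (@filterS _ G) => y; exact: XY.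
Qed.

(** Filters stand for closed sets of ultrafilters, so that a subidempotent
    filter is a closed subsemigroup; a maximal one is a minimal subsemigroup,
    and the argument of Ellis shows that it is a single idempotent. *)
Lemma maximal_subidempotent_ultra F : subidempotent F ->
  (forall G, subidempotent G -> F `<=` G -> G = F) -> UltraFilter F.
Proof.
move=> [FF Fi] Fmax.
(* [q] is a point of the semigroup [S] of [F].  First [S q = S] by minimality;
   then the [r] in [S] with [r q = q] form the closed semigroup of the filter [H],
   which is [S] again. *)
have [q [qU Fq]] := ultraFilterLemma FF.
have qF : ProperFilter q := @ultra_proper _ _ qU.
have Fq_eq : fprod F q = F.
  have sub : F `<=` fprod F q.
    by move=> X /Fi; apply: (@filterS _ F) => x; exact: Fq.
  apply: Fmax => //; split; first exact: fprod_filter.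
  move=> X hX; have FX := Fi _ hX; apply: sub; apply: (@filterS _ F) FX => x.
  rewrite /fprod /=; apply: (@filterS _ F) => y /=; apply: (@filterS _ q) => z /=.
  by rewrite -opA.
pose D X := [set x | q [set y | X (op x y)]].
pose H := [set Y | exists A X, [/\ F A, q X & A `&` D X `<=` Y]].
have DI X Y : D X `&` D Y `<=` D (X `&` Y).
  by move=> x [hX hY]; apply: filterI hX hY.
have HI : subidempotent H.
  have HF : ProperFilter H.
    apply: Build_ProperFilter_ex => [Y [A [X [FA qX AXY]]]|].
      apply: contrapT => nY.
      have : fprod F q (~` X).
        apply: (@filterS _ F) FA => x Ax /=.
        have [hx|hx] := in_ultra_setVsetC [set y | X (op x y)] qU; last exact: hx.
        by exfalso; apply: nY; exists x; apply: AXY; split.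
      rewrite Fq_eq => /Fq qX'.
      have /filter_ex[x [Xx nXx]] : q (X `&` ~` X) by exact: filterI.
      exact: nXx.
    split.
    - by exists setT, setT; split => //; exact: filterT.
    - move=> Y Y' [A [X [FA qX h]]] [A' [X' [FA' qX' h']]].
      exists (A `&` A'), (X `&` X'); split; [exact: filterI|exact: filterI|].
      move=> x [[Ax Ax']] hx; split; [apply: h|apply: h']; split => //.
        by move: hx; apply: (@filterS _ q) => y [].
      by move: hx; apply: (@filterS _ q) => y [].
    - move=> Y Y' YY' [A [X [FA qX h]]]; exists A, X; split => //.
      exact: subset_trans YY'.
  split => // Y [A [X [FA qX h]]].
  exists [set x | F [set y | A (op x y)]], X; split => //; first exact: Fi.
  move=> x [Fx Dx].
  exists [set y | A (op x y)], [set y | X (op x y)]; split => //.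
  move=> y [Ay Dy]; apply: h; split => //.
  by move: Dy; rewrite /D /=; apply: (@filterS _ q) => z; rewrite /= opA.
have HF_eq : H = F.
  apply: Fmax => // A FA; exists A, setT.
  by split => //; exact: filterT.
suff -> : F = q by [].
apply/seteqP; split => // X qX.
rewrite -Fq_eq /fprod /= -HF_eq.
by exists setT, X; split; [exact: filterT|exact: qX|move=> x []].
Qed.

Lemma idempotent_ultrafilter (F0 : set_system T) : subidempotent F0 ->
  exists p, [/\ UltraFilter p, F0 `<=` p & p `<=` fprod p p].
Proof.
move=> F0i.
pose E := {G : set_system T & subidempotent G /\ F0 `<=` G}.
pose R := fun G1 G2 : {classic E} => `[< projT1 G1 `<=` projT1 G2 >].
suff [G Gmax] : exists G : {classic E}, premaximal R G.
  have [Gi F0G] := projT2 G; exists (projT1 G); split => //; last by case: Gi.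
  apply: maximal_subidempotent_ultra => // H Hi GH.
  have F0H : F0 `<=` H by exact: subset_trans GH.
  have /asboolP HG := Gmax (existT _ H (conj Hi F0H)) (introT (asboolP _) GH).
  by apply/seteqP; split.
have F00 : F0 `<=` F0 by [].
apply: (ZL_preorder (existT _ F0 (conj F0i F00))).
- by move=> t; exact/asboolP.
- by move=> r s t /asboolP sr /asboolP st; apply/asboolP/(subset_trans _ st).
move=> A Atot; have [[G AG]|A0] := pselect (A !=set0); last first.
  by exists (existT _ F0 (conj F0i F00)) => G AG; exfalso; apply: A0; exists G.
have [_ F0G] := projT2 G.
pose U := \bigcup_(H in A) projT1 H.
have F0U : F0 `<=` U by move=> B FB; exists G => //; exact: F0G.
have Ui : subidempotent U.
  split; last first.
    move=> X [H AH HX]; have [[HF Hi] _] := projT2 H.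
    exists H => //; have := Hi _ HX; rewrite /fprod /=.
    by apply: (@filterS _ (projT1 H)) => x hx; exists H.
  apply: Build_ProperFilter_ex.
    by move=> B [H AH HB]; have [[HF _] _] := projT2 H; exact: (@filter_ex _ _ HF).
  split.
  - by exists G => //; have [[GF _] _] := projT2 G; exact: filterT.
  - move=> B C [HB AHB HBB] [HC AHC HCC].
    have [/asboolP h|/asboolP h] := Atot _ _ AHB AHC.
      exists HC => //; have [[HCF _] _] := projT2 HC.
      by apply: filterI HCC; exact: h.
    exists HB => //; have [[HBF _] _] := projT2 HB.
    by apply: filterI HBB _; exact: h.
  - move=> B C BC [H AH HB]; exists H => //; have [[HF _] _] := projT2 H.
    exact: filterS HB.
exists (existT _ U (conj Ui F0U)) => H AH.
by apply/asboolP => B HB; exists H.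
Qed.

End Idempotent.

(** * Limits of real functions along an ultrafilter *)

Lemma squeeze0 (R : realType) (T : Type) (F : set_system T) (f g : T -> R) :
  Filter F -> (forall x, 0 <= f x <= g x) -> g @ F --> (0 : R) ->
  f @ F --> (0 : R).
Proof.
move=> FF fg /cvgrPdist_lt g0; apply/cvgrPdist_lt => e e0.
apply: (@filterS _ F) (g0 e e0) => x /=.
rewrite !sub0r !normrN; apply: le_lt_trans.
by have /andP[f0 fgx] := fg x; rewrite !ger0_norm // (le_trans f0).
Qed.

Section UltraLimits.
Variables (R : realType) (T : Type) (p : set_system T).
Context {pU : UltraFilter p}.
Implicit Types f g : T -> R.

Lemma ultra_bounded_cvg f (C : R) : (forall x, `|f x| <= C) ->
  exists l : R, f @ p --> l.
Proof.
move=> fC.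
have [|l [_ lcl]] := @segment_compact R (- C) C (f @ p) _.
  change (p (f @^-1` `[- C, C])).
  by apply: (@filterS _ p _ setT) filterT => x _ /=; rewrite in_itv /= -ler_norml fC.
exists l => U Ul; have [//|nU] := in_ultra_setVsetC (f @^-1` U) pU.
have [z [/= nUz Uz]] := lcl (~` U) U nU Ul.
by exfalso; exact: nUz.
Qed.

Lemma ultra_meet (X Y : set T) : p X -> p Y -> exists x, X x /\ Y x.
Proof.
by move=> pX pY; have /filter_ex[x []] : p (X `&` Y); [exact: filterI|exists x].
Qed.

Lemma ultra_cvg_unique f (a b : R) : f @ p --> a -> f @ p --> b -> a = b.
Proof. by move=> fa fb; apply: cvg_unique fa fb; exact: Rhausdorff. Qed.

Lemma ultra_cvg_ge f (a b : R) : p [set x | a <= f x] -> f @ p --> b -> a <= b.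
Proof.
move=> fa fb; apply/ler_addgt0Pl => e e0.
have : p [set x | `|b - f x| < e] by move/cvgrPdist_lt : fb; exact.
move=> /(filterI fa)/filter_ex[x [/= ax]]; rewrite ltr_norml => /andP[+ _].
lra.
Qed.

Lemma ultra_cvg_le f (a b : R) : p [set x | f x <= a] -> f @ p --> b -> b <= a.
Proof.
move=> fa fb; rewrite -lerN2; apply: (@ultra_cvg_ge (fun x => - f x)).
  by apply: filterS fa => x /=; rewrite lerN2.
exact: cvgN.
Qed.

Lemma ultra_cvg_dist f (l e : R) : f @ p --> l -> 0 < e ->
  p [set x | `|f x - l| < e].
Proof.
move=> fl e0; have : p [set x | `|l - f x| < e] by move/cvgrPdist_lt : fl; exact.
by apply: (@filterS _ p) => x /=; rewrite distrC.
Qed.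

Lemma idempotent_cvg (op : T -> T -> T) f (g : T -> R) (l : R) :
  p `<=` fprod op p p -> f @ p --> l ->
  (forall x, (fun y => f (op x y)) @ p --> g x) -> g @ p --> l.
Proof.
move=> pi fl fg; apply/cvgrPdist_le => e e0.
have /pi := ultra_cvg_dist fl e0; rewrite /fprod /=.
apply: (@filterS _ p) => x hx /=; rewrite ler_norml.
have h1 : - e <= l - g x.
  suff : g x <= l + e by lra.
  apply: ultra_cvg_le (fg x); apply: filterS hx => y /=.
  by rewrite ltr_norml => /andP[_]; lra.
have h2 : l - g x <= e.
  suff : l - e <= g x by lra.
  apply: ultra_cvg_ge (fg x); apply: filterS hx => y /=.
  by rewrite ltr_norml => /andP[+ _]; lra.
by rewrite h1 h2.
Qed.

(** The bound is on squares because Cauchy-Schwarz provides it in this form. *)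
Lemma ultra_cvg_sqr f g h (l : R) :
  (forall x, (f x - g x) ^+ 2 <= h x) -> h @ p --> (0 : R) -> g @ p --> l ->
  f @ p --> l.
Proof.
move=> fgh h0 gl; apply/cvgrPdist_lt => e e0.
have e2 : 0 < e / 2 by lra.
have e4 : 0 < (e / 2) ^+ 2 by rewrite exprn_gt0.
have : p ([set x | `|h x - 0| < (e / 2) ^+ 2] `&` [set x | `|g x - l| < e / 2]).
  by apply: filterI; exact: ultra_cvg_dist.
apply: (@filterS _ p) => x [/= + gx]; rewrite subr0 => hx.
have fg : `|f x - g x| < e / 2.
  rewrite -(@ltr_pXn2r _ 2) ?nnegrE ?(ltW e2) // real_normK ?num_real //.
  by apply: le_lt_trans (fgh x) _; apply: le_lt_trans hx; exact: ler_norm.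
rewrite distrC; have -> : f x - l = (f x - g x) + (g x - l) by ring.
by apply: le_lt_trans (ler_normD _ _) _; lra.
Qed.

End UltraLimits.

(** * Weak limits in a Hilbert space *)

Record inner_product (R : realType) (V : lmodType R) (ip : V -> V -> R) : Prop :=
  InnerProduct {
  ipC : forall u v, ip u v = ip v u;
  ipDl : forall u v w, ip (u + v) w = ip u w + ip v w;
  ipZl : forall a u w, ip (a *: u) w = a * ip u w;
  ip_ge0 : forall u, 0 <= ip u u }.

(** A real Hilbert space, up to vectors of length zero: completeness enters only
    through the Riesz representation of bounded functionals. *)
Record hilbert (R : realType) (V : lmodType R) (ip : V -> V -> R) : Prop :=
  Hilbert {
  hilbert_ip :> inner_product ip;
  riesz : forall (xi : V -> R) (C : R),
    (forall u v, xi (u + v) = xi u + xi v) ->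
    (forall a u, xi (a *: u) = a * xi u) ->
    (forall u, xi u ^+ 2 <= C * ip u u) ->
    exists w, forall v, xi v = ip w v }.

Section InnerProduct.
Variables (R : realType) (V : lmodType R) (ip : V -> V -> R).
Hypothesis hV : inner_product ip.
Implicit Types u v w : V.

Lemma ipDr u v w : ip u (v + w) = ip u v + ip u w.
Proof. by rewrite (ipC hV) (ipDl hV) !(ipC hV _ u). Qed.

Lemma ipZr a u v : ip u (a *: v) = a * ip u v.
Proof. by rewrite (ipC hV) (ipZl hV) (ipC hV). Qed.

Lemma ipNl u v : ip (- u) v = - ip u v.
Proof. by rewrite -scaleN1r (ipZl hV) mulN1r. Qed.

Lemma ipNr u v : ip u (- v) = - ip u v.
Proof. by rewrite (ipC hV) ipNl (ipC hV). Qed.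

Lemma ipBl u v w : ip (u - v) w = ip u w - ip v w.
Proof. by rewrite (ipDl hV) ipNl. Qed.

Lemma ipBr u v w : ip u (v - w) = ip u v - ip u w.
Proof. by rewrite ipDr ipNr. Qed.

Lemma ip0l v : ip 0 v = 0.
Proof. by rewrite -(scale0r 0) (ipZl hV) mul0r. Qed.

Lemma ip0r v : ip v 0 = 0.
Proof. by rewrite (ipC hV) ip0l. Qed.

Lemma ipDD u v : ip (u + v) (u + v) = ip u u + 2 * ip u v + ip v v.
Proof. by rewrite (ipDl hV) !ipDr (ipC hV v u); ring. Qed.

Lemma ipBB u v : ip (u - v) (u - v) = ip u u - 2 * ip u v + ip v v.
Proof. by rewrite ipBl !ipBr (ipC hV v u); ring. Qed.

Lemma discriminant (a b c : R) : (forall t, 0 <= a + 2 * t * b + t ^+ 2 * c) ->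
  b ^+ 2 <= a * c.
Proof.
move=> h; have a0 : 0 <= a by have := h 0; rewrite expr2; lra.
have c0 : 0 <= c.
  have [//|c0] := leP 0 c; exfalso.
  pose t := (a + 1) / - c + 1.
  have tc : (t - 1) * - c = a + 1 by rewrite /t addrK divfK // gt_eqF // oppr_gt0.
  have t1 : 1 <= t by rewrite lerDr divr_ge0 //; lra.
  have := h t; have := h (- t); rewrite sqrrN expr2.
  by nra.
have [c00|c0'] := eqVneq c 0.
  rewrite c00 mulr0; have [->|b0] := eqVneq b 0; first by rewrite expr0n.
  have := h (- (a + 1) / (2 * b)); rewrite c00 mulr0 addr0.
  have -> : 2 * (- (a + 1) / (2 * b)) * b = - (a + 1) by field.
  lra.
have cp : 0 < c by rewrite lt_def c0' c0.
have := h (- b / c).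
have -> : a + 2 * (- b / c) * b + (- b / c) ^+ 2 * c = a - b ^+ 2 / c by field.
by rewrite subr_ge0 ler_pdivrMr.
Qed.

Lemma cauchy_schwarz u v : ip u v ^+ 2 <= ip u u * ip v v.
Proof.
apply: discriminant => t; have := ip_ge0 hV (u + t *: v).
by rewrite ipDD !ipZr (ipZl hV) expr2; lra.
Qed.

Lemma ip_null u v : ip u u = 0 -> ip u v = 0.
Proof.
move=> u0; apply/eqP; rewrite -sqrf_eq0 eq_le sqr_ge0 andbT.
by apply: le_trans (cauchy_schwarz u v) _; rewrite u0 mul0r.
Qed.

End InnerProduct.

Section Hilbert.
Variables (R : realType) (V : lmodType R) (ip : V -> V -> R).
Hypothesis hV : hilbert ip.
Implicit Types u v w : V.

Lemma sqr_norm_le (x K : R) : x ^+ 2 <= K -> `|x| <= K + 1.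
Proof.
move=> h; have n0 := normr_ge0 x.
have : 0 <= (`|x| - 1) ^+ 2 by exact: sqr_ge0.
have : `|x| ^+ 2 = x ^+ 2 by rewrite real_normK ?num_real.
by rewrite sqrrB1 => ->; lra.
Qed.

Section Limits.
Variables (T : Type) (p : set_system T).
Context {pU : UltraFilter p}.

Lemma ip_bounded_cvg (u : T -> V) C v : (forall x, ip (u x) (u x) <= C) ->
  exists l : R, (fun x => ip (u x) v) @ p --> l.
Proof.
move=> uC; apply: (@ultra_bounded_cvg _ _ p _ _ (C * ip v v + 1)) => x.
apply: sqr_norm_le; apply: le_trans (cauchy_schwarz hV _ _) _.
by rewrite ler_wpM2r ?(ip_ge0 hV).
Qed.

Definition wlim (u : T -> V) : V :=
  xget 0 [set w | forall v, (fun x => ip (u x) v) @ p --> ip w v].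

Lemma wlimP (u : T -> V) C : (forall x, ip (u x) (u x) <= C) ->
  forall v, (fun x => ip (u x) v) @ p --> ip (wlim u) v.
Proof.
move=> uC; rewrite /wlim; case: xgetP => [w -> //|none]; exfalso.
have lP v := cid (ip_bounded_cvg v uC).
pose xi v := projT1 (lP v).
have xiP v : (fun x => ip (u x) v) @ p --> xi v := projT2 (lP v).
have [|||w hw] := @riesz _ _ _ hV xi C; last first.
- by apply: (none w) => v; rewrite -hw; exact: xiP.
- move=> v; rewrite expr2; have h : (fun x => ip (u x) v * ip (u x) v) @ p --> xi v * xi v.
    by apply: cvgM; exact: xiP.
  apply: (@ultra_cvg_le _ _ p _ _ _ _ _ h).
  apply: (@filterS _ p _ setT) filterT => x _ /=.
  rewrite -expr2; apply: le_trans (cauchy_schwarz hV _ _) _.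
  by rewrite ler_wpM2r ?(ip_ge0 hV).
- move=> a v; apply: (@ultra_cvg_unique _ _ p _ _ _ _ (xiP _)).
  under eq_fun do rewrite (ipZr hV).
  by apply: cvgM; [exact: cvg_cst|exact: xiP].
- move=> v w; apply: (@ultra_cvg_unique _ _ p _ _ _ _ (xiP _)).
  under eq_fun do rewrite (ipDr hV).
  by apply: cvgD; exact: xiP.
Qed.

Lemma wlim_le (u : T -> V) C : (forall x, ip (u x) (u x) <= C) ->
  ip (wlim u) (wlim u) <= C.
Proof.
move=> uC; set w := wlim u.
have C0 : 0 <= C.
  have [x _] := filter_ex (@filterT _ p _).
  by apply: le_trans (uC x); exact: (ip_ge0 hV).
have h : ip w w ^+ 2 <= C * ip w w.
  have hc : (fun x => ip (u x) w) @ p --> ip w w by exact: wlimP uC _.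
  have h : (fun x => ip (u x) w * ip (u x) w) @ p --> ip w w * ip w w.
    by apply: cvgM; exact: hc.
  rewrite expr2.
  apply: (@ultra_cvg_le _ _ p _ _ _ _ _ h).
  apply: (@filterS _ p _ setT) filterT => x _ /=.
  rewrite -expr2; apply: le_trans (cauchy_schwarz hV _ _) _.
  by rewrite ler_wpM2r ?(ip_ge0 hV).
have w0 := ip_ge0 hV w.
have [->//|w0'] := eqVneq (ip w w) 0.
by rewrite expr2 ler_pM2r // lt_def w0' w0 in h.
Qed.

End Limits.

Section VanDerCorput.
Variables (T : eqType) (op : T -> T -> T) (one : T) (p : set_system T).
Hypothesis opA : associative op.
Hypothesis op1l : left_id one op.
Context {pU : UltraFilter p}.
Hypothesis pi : p `<=` fprod op p p.

(** If the weak limit had positive inner product [l] with [v], one could choose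
    arbitrarily long sums of terms [u (op t z)] that are almost orthogonal to each
    other, the multipliers [t] being built by repeated use of idempotence; such a
    sum of [k] terms has length of order [sqrt k], but inner product at least
    [k * l / 2] with [v]. *)
Lemma van_der_corput (u : T -> V) (c : T -> R) (C : R) :
  (forall x, ip (u x) (u x) <= C) ->
  (forall x, (fun y => ip (u y) (u (op x y))) @ p --> c x) ->
  c @ p --> (0 : R) ->
  forall v, (fun y => ip (u y) v) @ p --> (0 : R).
Proof.
move=> uC uc c0.
suff pos v l : (fun y => ip (u y) v) @ p --> l -> l <= 0.
  move=> v; have [l hl] := ip_bounded_cvg v uC.
  suff -> : (0 : R) = l by [].
  apply/eqP; rewrite eq_le (pos v l hl) andbT -oppr_le0.
  apply: (pos (- v)).
  by under eq_fun do rewrite (ipNr hV); exact: cvgN.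
move=> hl; have [//|l0] := leP l 0; exfalso.
have C0 : 0 <= C by apply: le_trans (uC one); exact: (ip_ge0 hV).
set Q := ip v v; have Q0 : 0 <= Q by exact: (ip_ge0 hV).
pose e := l ^+ 2 / (16 * (Q + 1)).
have e0 : 0 < e by rewrite divr_gt0 ?exprn_gt0 // mulr_gt0 // ltr_wpDl.
pose A := [set x | `|c x| < e].
have pA : p A.
  have : p [set x | `|c x - 0| < e] by exact: ultra_cvg_dist.
  by apply: (@filterS _ p) => x /=; rewrite subr0.
pose S (ts : seq T) z := \sum_(t <- ts) u (op t z).
pose G (ts : seq T) := [set z | [/\ forall t, t \in ts -> A (op t z),
   ip (S ts z) (S ts z) <= (size ts)%:R * C + (size ts * (size ts).+1)%:R * e &
   (size ts)%:R * (l / 2) <= ip (S ts z) v]].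
have step k : exists ts, size ts = k /\ p (G ts).
  elim: k => [|k [ts [sts pG]]].
    exists [::]; split => //; apply: (@filterS _ p _ setT) filterT => z _.
    by split => //; rewrite /S big_nil ?(ip0l hV) ?mul0r ?mul0n ?mul0r ?addr0.
  have /filter_ex[x [Gx pGx]] : p (G ts `&` [set x | p [set z | G ts (op x z)]]).
    by apply: filterI => //; exact: pi.
  have {Gx} [Ax _ _] := Gx.
  pose ts' := [seq op t x | t <- ts].
  exists (one :: ts'); split; first by rewrite /= size_map sts.
  have cvgS : (fun z => ip (u z) (S ts' z)) @ p --> \sum_(t <- ts) c (op t x).
    rewrite /S /ts' {pG pGx ts' sts Ax}.
    elim: ts => [|t ts IH].
      rewrite big_nil; under eq_fun do rewrite big_nil (ip0r hV).
      exact: cvg_cst.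
    rewrite big_cons; under eq_fun do rewrite /= big_cons (ipDr hV).
    by apply: cvgD => //; exact: uc.
  have sumc : \sum_(t <- ts) c (op t x) <= k%:R * e.
    rewrite -sts {pG pGx ts' sts cvgS}; elim: ts Ax => [|t ts IH] Ax.
      by rewrite big_nil mul0r.
    rewrite big_cons -[size _]/(size ts).+1 -natr1 mulrDl mul1r addrC lerD //.
      by apply: IH => t' t'ts; apply: Ax; rewrite in_cons t'ts orbT.
    have /ltW : `|c (op t x)| < e by apply: Ax; rewrite mem_head.
    by apply: le_trans; exact: ler_norm.
  have h1 : p [set z | `|ip (u z) (S ts' z) - \sum_(t <- ts) c (op t x)| < e].
    exact: ultra_cvg_dist.
  have h2 : p [set z | `|ip (u z) v - l| < l / 2].
    by apply: ultra_cvg_dist => //; rewrite divr_gt0.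
  have : p ([set z | G ts (op x z)] `&` (A `&`
      ([set z | `|ip (u z) (S ts' z) - \sum_(t <- ts) c (op t x)| < e] `&`
       [set z | `|ip (u z) v - l| < l / 2]))).
    by do 3 (apply: filterI => //).
  apply: (@filterS _ p) => z [/= [Gz1 Gz2 Gz3] [Az [z1 z2]]].
  have Sts' : S ts' z = S ts (op x z).
    by rewrite /S /ts' big_map; under eq_bigr do rewrite -opA.
  have SE : S (one :: ts') z = u z + S ts (op x z).
    by rewrite -Sts' /S big_cons op1l.
  have uz := uC z.
  move: z1 z2; rewrite !ltr_norml => /andP[_ z1] /andP[z2 _].
  rewrite -Sts' sts in Gz2 Gz3.
  split.
  - move=> t; rewrite in_cons => /predU1P[->|/mapP[t' t'ts ->]].
      by rewrite op1l.
    by rewrite -opA; exact: Gz1.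
  - rewrite SE -Sts' (ipDD hV) /= size_map sts.
    have -> : (k.+1 * k.+2)%:R = (k * k.+1)%:R + 2 * k.+1%:R :> R.
      by rewrite -natrM -natrD; congr (_%:R); lia.
    by rewrite -natr1; lra.
  - rewrite SE -Sts' (ipDl hV) /= size_map sts -natr1.
    by move: Gz3 z2; lra.
have [k hk] : exists k : nat, 8 * C * Q < k%:R * l ^+ 2.
  have l2 : 0 < l ^+ 2 by rewrite exprn_gt0.
  exists (Num.truncn (8 * C * Q / l ^+ 2)).+1.
  rewrite -ltr_pdivrMr //.
  have := Num.Theory.truncnS_gt (8 * C * Q / l ^+ 2).
  by [].
have [ts [sts /filter_ex[z [_ h1 h2]]]] := step k.
rewrite sts in h1 h2.
have k0 : 0 < k%:R :> R.
  rewrite ltr0n; case: k hk {sts h1 h2 step} => // hk.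
  by move: hk; rewrite mul0r ltNge mulr_ge0 // mulr_ge0.
have : (k%:R * (l / 2)) ^+ 2 <= (k%:R * C + (k * k.+1)%:R * e) * Q.
  apply: (@le_trans _ _ (ip (S ts z) v ^+ 2)).
    rewrite ler_sqr ?nnegrE //; last by apply: le_trans h2; rewrite mulr_ge0 // ltW // divr_gt0.
    by rewrite mulr_ge0 // ?ltW // divr_gt0.
  by apply: le_trans (cauchy_schwarz hV _ _) _; rewrite ler_wpM2r.
have eQ : 16 * (e * Q) <= l ^+ 2.
  have -> : 16 * (e * Q) = l ^+ 2 * (Q / (Q + 1)).
    by rewrite /e; field; rewrite gt_eqF // ltr_wpDl.
  rewrite ler_piMr ?sqr_ge0 // ler_pdivrMr ?mul1r; last by rewrite ltr_wpDl.
  by rewrite lerDl.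
have kk : (k * k.+1)%:R <= 2 * k%:R * k%:R :> R.
  rewrite -!natrM ler_nat; case: k k0 {hk sts h1 h2 step} => [|k _]; last by lia.
  by rewrite ltxx.
have eQ0 : 0 <= e * Q by rewrite mulr_ge0 // ltW.
have kke : (k * k.+1)%:R * (e * Q) <= 2 * k%:R * k%:R * (e * Q).
  by rewrite ler_wpM2r.
rewrite mulrDl -[X in _ <= _ + X -> _]mulrA => h.
have hk2 : k%:R * (8 * C * Q) < k%:R * (k%:R * l ^+ 2) by rewrite ltr_pM2l.
have hk3 : k%:R * k%:R * (16 * (e * Q)) <= k%:R * k%:R * l ^+ 2.
  by rewrite ler_wpM2l // mulr_ge0 // ltW.
have e1 : (k%:R * (l / 2)) ^+ 2 = k%:R * k%:R * l ^+ 2 / 4 by field.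
rewrite e1 in h.
move: h kke hk2 hk3; move: (e * Q) => E; rewrite !mulrA.
by lra.
Qed.

End VanDerCorput.

End Hilbert.

(** * Commuting projections with an ascending chain condition *)

Section Projections.
Variables (R : realType) (V : lmodType R) (ip : V -> V -> R).
Hypothesis hV : hilbert ip.
Implicit Types (u v w f g : V) (S T : V -> V).

(** Vectors are only compared through inner products: operators are projections,
    commute, or fix a vector up to vectors of length zero. *)
Definition isproj T := forall f g, ip (T f) (T g) = ip (T f) g.
Definition commuting S T := forall f g, ip (S (T f)) g = ip (T (S f)) g.
Definition fixes T f := forall g, ip (T f) g = ip f g.

Lemma isproj_sym T f g : isproj T -> ip (T f) g = ip f (T g).
Proof. by move=> hT; rewrite -hT (ipC hV) hT (ipC hV). Qed.

Lemma isproj_idem T f : isproj T -> fixes T (T f).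
Proof. by move=> hT g; rewrite isproj_sym // hT. Qed.

Lemma isproj_congr T u v : isproj T -> (forall g, ip u g = ip v g) ->
  forall g, ip (T u) g = ip (T v) g.
Proof. by move=> hT uv g; rewrite !(isproj_sym _ _ hT). Qed.

Lemma isproj_null T f : isproj T -> ip (T f) f = 0 -> forall g, ip (T f) g = 0.
Proof. by move=> hT f0 g; apply: (ip_null hV); rewrite hT. Qed.

Lemma isproj_comp S T : isproj S -> isproj T -> commuting S T ->
  isproj (S \o T).
Proof. by move=> hS hT ST f g /=; rewrite hS ST hT -ST. Qed.

(** For [u] in the image and [v] in the kernel, [u + t *: v] is mapped to [u] for
    all [t], and a contraction allows this only if [u] and [v] are orthogonal. *)
Lemma contraction_isproj T :
  (forall u v w, ip (T (u + v)) w = ip (T u) w + ip (T v) w) ->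
  (forall a u w, ip (T (a *: u)) w = a * ip (T u) w) ->
  (forall u, ip (T u) (T u) <= ip u u) ->
  (forall u, fixes T (T u)) -> isproj T.
Proof.
move=> TD TZ Tle TT f g; pose u := T f; pose v := g - T g.
have Tv w : ip (T v) w = 0.
  by rewrite /v TD -scaleN1r TZ TT; ring.
suff : ip u v ^+ 2 <= 0 * ip v v.
  rewrite mul0r => h; have /eqP : ip u v ^+ 2 = 0.
    by apply/eqP; rewrite eq_le h sqr_ge0.
  by rewrite sqrf_eq0 (ipBr hV) subr_eq0 => /eqP ->.
apply: (discriminant) => t.
have Tz w : ip (T (u + t *: v)) w = ip u w.
  by rewrite TD TZ Tv mulr0 addr0 TT.
have := Tle (u + t *: v); rewrite Tz (ipC hV) Tz (ipDD hV) (ipZr hV).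
by rewrite (ipZl hV) (ipZr hV) expr2; lra.
Qed.

Variables (I : Type) (Pi : I -> V -> V).
Hypothesis Pi_proj : forall i, isproj (Pi i).
Hypothesis Pi_comm : forall i j, commuting (Pi i) (Pi j).
Hypothesis acc : forall f : nat -> V,
  (forall n i, fixes (Pi i) (f n) -> fixes (Pi i) (f n.+1)) ->
  exists N, forall n i, fixes (Pi i) (f n) -> fixes (Pi i) (f N).

(** Applying projections of the family as long as one of them neither fixes nor
    kills the vector must end, by the chain condition, at a vector that each
    projection fixes or kills. *)
Lemma atom_exists g0 : ip g0 g0 != 0 ->
  exists S, [/\ isproj S, ip (S g0) (S g0) != 0 &
    forall i, fixes (Pi i) (S g0) \/ forall g, ip (Pi i (S g0)) g = 0].
Proof.
move=> g00; apply: contrapT => none.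
pose good S := [/\ isproj S, (forall i, commuting (Pi i) S) &
  ip (S g0) (S g0) != 0].
have next (S : {S | good S}) : {S' : {S | good S} |
    (forall i, fixes (Pi i) (projT1 S g0) -> fixes (Pi i) (projT1 S' g0)) /\
    exists i, fixes (Pi i) (projT1 S' g0) /\ ~ fixes (Pi i) (projT1 S g0)}.
  apply: cid; case: S => S [hS cS S0] /=.
  have [i [nfix nkill]] : exists i, ~ fixes (Pi i) (S g0) /\
      ~ forall g, ip (Pi i (S g0)) g = 0.
    apply: contrapT => h; apply: none; exists S; split => // i.
    apply: contrapT => h'; apply: h; exists i.
    by split=> h''; apply: h'; [left|right].
  have gS' : good (Pi i \o S).
    split; first exact: isproj_comp.
    - move=> j f g /=; rewrite Pi_comm; apply: isproj_congr => // {}g.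
      exact: cS.
    - apply/eqP => h /=; apply: nkill => g.
      by apply: (ip_null hV).
  exists (exist _ (Pi i \o S) gS'); split => [j /= fj g|].
    by rewrite Pi_comm; exact: isproj_congr.
  by exists i; split => //=; exact: isproj_idem.
have good_id : good id by split => // f g.
pose nx (W : {S | good S}) := projT1 (next W).
pose sq n := iter n nx (exist _ id good_id).
have [n i|N hN] := acc (f := fun n => projT1 (sq n) g0).
  by rewrite [sq n.+1]iterS; have [h _] := projT2 (next (sq n)); exact: h.
have [_ [i [hi nhi]]] := projT2 (next (sq N)).
by apply: nhi; apply: (hN N.+1); rewrite [sq N.+1]iterS.
Qed.

Variables (T : Type) (p : set_system T).
Context {pU : UltraFilter p}.

(** On a vector that is fixed or killed by each projection, the limit is the
    identity or zero; such vectors are total. *)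
Lemma projection_limit (k : T -> I) : exists2 Q, isproj Q &
  forall f g, (fun x => ip (Pi (k x) f) g) @ p --> ip (Q f) g.
Proof.
have le f i : ip (Pi i f) (Pi i f) <= ip f f.
  have := cauchy_schwarz hV (Pi i f) f; rewrite -(Pi_proj i).
  move: (ip_ge0 hV (Pi i f)) (ip_ge0 hV f).
  move: (ip (Pi i f) _) (ip f f) => a b a0 b0; rewrite expr2.
  by have [->//|a1] := eqVneq a 0; rewrite ler_pM2l // lt_def a1.
pose Q f := wlim ip p (fun x => Pi (k x) f).
have QP f g : (fun x => ip (Pi (k x) f) g) @ p --> ip (Q f) g.
  by apply: (wlimP hV) => x; exact: le.
have Qs f g : ip (Q f) g = ip f (Q g).
  apply: (@ultra_cvg_unique _ _ p _ _ _ _ (QP f g)).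
  rewrite (ipC hV); under eq_fun do rewrite isproj_sym // (ipC hV).
  exact: QP.
exists Q => // f g.
pose g0 := Q (Q f) - Q f.
suff g00 : ip g0 g0 = 0.
  rewrite -Qs; apply/eqP; rewrite -subr_eq0 -(ipBl hV).
  by apply/eqP; exact: (ip_null hV).
apply: contrapT => /eqP/atom_exists[S [hS S0 hat]]; apply/negP: S0; rewrite negbK.
pose u := S g0.
(* This dichotomy is where the limit has to be along an ultrafilter. *)
have Qu : (forall h, ip (Q u) h = ip u h) \/ (forall h, ip (Q u) h = 0).
  have [h|h] := in_ultra_setVsetC [set x | fixes (Pi (k x)) u] pU.
    left => w; apply: (@ultra_cvg_unique _ _ p _ _ _ _ (QP u w)).
    apply: (cvg_near_cst); apply: (@filterS _ p) h => x /= fx; exact: fx.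
  right => w; apply: (@ultra_cvg_unique _ _ p _ _ _ _ (QP u w)).
  apply: (cvg_near_cst); apply: (@filterS _ p) h => x /= nfx.
  by have [//|] := hat (k x); apply.
rewrite hS -[S g0]/u /g0 (ipBr hV); apply/eqP.
have [hQ|hQ] := Qu; first by rewrite -(Qs u (Q f)) hQ subrr.
by rewrite -(Qs u (Q f)) -(Qs u f) !hQ subrr.
Qed.

End Projections.

(** * Limits of polynomial families of isometries *)

Section PolynomialLimits.
Variables (R : realType) (V : lmodType R) (ip : V -> V -> R).
Hypothesis hV : hilbert ip.
Variables (T : eqType) (op : T -> T -> T) (one : T) (XT : seq T).
Variables (p : set_system T).
Hypothesis opA : associative op.
Hypothesis op1l : left_id one op.
Hypothesis op1r : right_id one op.
Hypothesis genXT : forall P : set T, P one ->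
  (forall x y, x \in XT -> P y -> P (op x y)) -> forall y, P y.
Context {pU : UltraFilter p}.
Hypothesis pi : p `<=` fprod op p p.

Variables (Gam : groupType) (F : nat -> set Gam) (m : nat) (X : seq Gam).
Hypothesis hF : filtration F.
Hypothesis Fm : forall i, (m <= i)%N -> F i `<=` [set 1%g].
Hypothesis FX : forall x, x \in X -> F 1%N x.
Hypothesis FgenX : forall i x, F i x -> gen X x.

Variable U : Gam -> V -> V.
Hypothesis UD : forall h u v, U h (u + v) = U h u + U h v.
Hypothesis UZ : forall h a u, U h (a *: u) = a *: U h u.
Hypothesis U_ip : forall h u v, ip (U h u) (U h v) = ip u v.
Hypothesis UM : forall h k u, U (h * k)%g u = U h (U k u).
Hypothesis U1 : forall u, U 1%g u = u.

Notation isproj := (isproj ip).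
Notation commuting := (commuting ip).
Notation fixes := (fixes ip).
Implicit Types (u v w f g : V) (s t : T -> Gam).

Lemma U_adj h u v : ip (U h u) v = ip u (U h^-1%g v).
Proof. by rewrite -(U_ip h^-1%g) -UM mulVg U1. Qed.

Lemma UB h u v : U h (u - v) = U h u - U h v.
Proof. by rewrite -[- v]scaleN1r UD UZ scaleN1r. Qed.

Lemma U_norm h u : ip (U h u) (U h u) = ip u u. Proof. exact: U_ip. Qed.

Lemma U_diff h k f v :
  (ip (U (h * k)%g f) v - ip (U h f) v) ^+ 2 <=
  ip (U k f - f) (U k f - f) * ip v v.
Proof.
rewrite -(ipBl hV) UM -UB; apply: le_trans (cauchy_schwarz hV _ _) _.
by rewrite U_norm.
Qed.

Definition lim_op s f := wlim ip p (fun y => U (s y) f).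

Lemma lim_opP s f g : (fun y => ip (U (s y) f) g) @ p --> ip (lim_op s f) g.
Proof. by apply: (wlimP hV) => y; rewrite U_norm. Qed.

Local Arguments lim_opP : clear implicits.

Let uniq := @ultra_cvg_unique R T p pU.

Lemma lim_opD s u v w : ip (lim_op s (u + v)) w = ip (lim_op s u) w + ip (lim_op s v) w.
Proof.
apply: (uniq (lim_opP _ _ _)).
under eq_fun do rewrite UD (ipDl hV).
by apply: cvgD; exact: lim_opP.
Qed.

Lemma lim_opZ s a u w : ip (lim_op s (a *: u)) w = a * ip (lim_op s u) w.
Proof.
apply: (uniq (lim_opP _ _ _)).
under eq_fun do rewrite UZ (ipZl hV).
by apply: cvgM; [exact: cvg_cst|exact: lim_opP].
Qed.

Lemma lim_op_le s u : ip (lim_op s u) (lim_op s u) <= ip u u.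
Proof. by apply: (wlim_le hV) => y; rewrite U_norm. Qed.

Lemma lim_op_adj s u v : ip (lim_op s u) v = ip u (lim_op (fun y => (s y)^-1%g) v).
Proof.
apply: (uniq (lim_opP _ _ _)); rewrite (ipC hV).
under eq_fun do rewrite U_adj (ipC hV).
exact: lim_opP.
Qed.

Definition disp s f y := ip (U (s y) f - f) (U (s y) f - f).

Lemma disp_cvg s f : disp s f @ p --> 2 * ip f f - 2 * ip (lim_op s f) f.
Proof.
have -> : disp s f = fun y => 2 * ip f f - 2 * ip (U (s y) f) f.
  by apply: funext => y; rewrite /disp (ipBB hV) U_norm; ring.
apply: cvgB; first exact: cvg_cst.
by apply: cvgM; [exact: cvg_cst|exact: lim_opP].
Qed.

Local Arguments disp_cvg : clear implicits.

Lemma fixes_disp s f : fixes (lim_op s) f <-> disp s f @ p --> (0 : R).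
Proof.
split=> [fx|d0 g].
  by have := disp_cvg s f; rewrite fx subrr.
apply: (uniq (lim_opP _ _ _)).
apply: (ultra_cvg_sqr (g := fun=> ip f g) (h := fun y => disp s f y * ip g g)).
- by move=> y; rewrite -(ipBl hV); exact: (cauchy_schwarz hV).
- by rewrite -(mul0r (ip g g)); apply: cvgM => //; exact: cvg_cst.
- exact: cvg_cst.
Qed.

Lemma fixes_lim_op1 f : fixes (lim_op (fun=> 1%g)) f.
Proof.
by move=> g; apply: (uniq (lim_opP _ _ _)); under eq_fun do rewrite U1; exact: cvg_cst.
Qed.

Lemma disp_div s t f y :
  disp (fun y => (s y)^-1 * t y)%g f y <= 2 * disp s f y + 2 * disp t f y.
Proof.
have -> : disp (fun y => (s y)^-1 * t y)%g f y =
    ip (U (t y) f - U (s y) f) (U (t y) f - U (s y) f).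
  rewrite /disp -(U_ip (s y)); congr (ip _ _);
    by rewrite UB -UM mulVKg.
rewrite /disp; set a := U (t y) f; set b := U (s y) f.
have -> : a - b = (a - f) - (b - f) by rewrite opprB addrA subrK.
have := ip_ge0 hV ((a - f) + (b - f)); rewrite (ipDD hV) (ipBB hV (a - f) (b - f)).
by lra.
Qed.

Lemma fixes_div s t f : fixes (lim_op s) f -> fixes (lim_op t) f ->
  fixes (lim_op (fun y => (s y)^-1 * t y)%g) f.
Proof.
move=> /fixes_disp sf /fixes_disp tf; apply/fixes_disp.
have h : (fun y => 2 * disp s f y + 2 * disp t f y) @ p --> (0 : R).
  have -> : (0 : R) = 2 * 0 + 2 * 0 by ring.
  by apply: cvgD; apply: cvgM => //; exact: cvg_cst.
by apply: (squeeze0 _ _ h) => y; rewrite (ip_ge0 hV) disp_div.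
Qed.

Definition based_poly i := [set s : T -> Gam | poly op F i s /\ s one = 1%g].

Lemma based_polyS i s : based_poly i.+1 s -> based_poly i s.
Proof. by move=> [hs s1]; split => //; exact: (polyW hF (leqnSn i)). Qed.

Lemma based_poly_val i s x : based_poly i s -> F i.+1 (s x).
Proof.
move=> [hs s1]; have -> : s x = der op x s one.
  by rewrite /der s1 op1r invg1 mul1g.
exact: poly_val (poly_der x hs) one.
Qed.

(** The stabilisers of the [f n] are groups of polynomial maps, determined by
    their values on the words of length less than [m]. *)
Lemma lim_op_acc i (f : nat -> V) :
  (forall n s, based_poly i s -> fixes (lim_op s) (f n) -> fixes (lim_op s) (f n.+1)) ->
  exists N, forall n s, based_poly i s -> fixes (lim_op s) (f n) -> fixes (lim_op s) (f N).
Proof.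
move=> hf; pose L n := [set s | based_poly i s /\ fixes (lim_op s) (f n)].
have [l [lc lX lg]] := polycyclic_list hF Fm FX.
suff [N hN] : exists N, forall n s, L n s -> L N s.
  by exists N => n s Ks fs; have [] := hN n s (conj Ks fs).
apply: (@chain_stable T Gam X L _ _ _ (words op one XT m) l lc lg).
- by move=> n s [Ks fs]; split => //; exact: hf.
- by move=> n; split; [split => //; exact: (poly1 op hF)|exact: fixes_lim_op1].
- move=> n s t [[Ks s1] fs] [[Kt t1] ft]; split; last exact: fixes_div.
  split; last by rewrite s1 t1 invg1 mulg1.
  by apply: (polyM hF) => //; exact: (polyV hF).
- by move=> n s [[Ks _] _] y; rewrite lX; exact: FgenX (poly_val Ks y).
- by move=> n s [[Ks _] _]; exact: (poly_determined genXT Fm Ks).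
Qed.

(** The induction hypothesis: commutation is needed at the next level, since
    the limit of the projections of the [delta s x] is formed there. *)
Definition good_level i := (forall s, based_poly i s -> isproj (lim_op s)) /\
  (forall s t, based_poly i s -> based_poly i t -> commuting (lim_op s) (lim_op t)).

Section Step.
Variable i : nat.
Hypothesis IH : good_level i.+1.

Lemma limit_projection (k : T -> T -> Gam) : (forall x, based_poly i.+1 (k x)) ->
  exists2 Q, isproj Q &
    forall f g, (fun x => ip (lim_op (k x) f) g) @ p --> ip (Q f) g.
Proof.
move=> hk; have [IHp IHc] := IH.
pose Pi (s : {s | based_poly i.+1 s}) := lim_op (projT1 s).
have := @projection_limit _ _ _ hV _ Pi _ _ _ _ p pU.
move=> /(_ _ _ _ (fun x => exist _ (k x) (hk x))); apply.
- by move=> s; apply: IHp; exact: projT2.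
- by move=> s t; apply: IHc; exact: projT2.
move=> f hf; have [|N hN] := @lim_op_acc i.+1 f.
  by move=> n s Ks; exact: (hf n (exist _ s Ks)).
by exists N => n s; exact: hN (projT2 s).
Qed.

(** The defect of [s] from being an antihomomorphism lies one level deeper. *)
Definition delta s x y := ((s x)^-1 * (s y)^-1 * s (op x y))%g.

Lemma delta_based s x : based_poly i s -> based_poly i.+1 (delta s x).
Proof.
move=> Ks; have [hs s1] := Ks.
split; last by rewrite /delta s1 op1r invg1 mulg1 mulVg.
have -> : delta s x = fun y => ((s x)^-1 * der op x s y)%g.
  by apply: funext => y; rewrite /delta /der mulgA.
apply: (polyM hF); last exact: poly_der.
by apply: (poly_const _ hF); apply: (filV hF); exact: based_poly_val.
Qed.

Lemma deltaE s x y : s (op x y) = (s y * (s x * delta s x y))%g.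
Proof. by rewrite /delta; group_word; rewrite -!mulgA mulVKg mulVKg. Qed.

(** Van der Corput: the correlation of [U (s y) f] with [U (s (op x y)) f] tends in
    [y] to an inner product with the projection of [f] for [delta s x]. *)
Lemma delta_kill s Q f : based_poly i s ->
  (forall f g, (fun x => ip (lim_op (delta s x) f) g) @ p --> ip (Q f) g) ->
  (forall g, ip (Q f) g = 0) -> forall g, ip (lim_op s f) g = 0.
Proof.
move=> Ks QP Qf g; have [IHp _] := IH.
apply: (uniq (lim_opP _ _ _)).
apply: (van_der_corput hV opA op1l pi (C := ip f f)
  (c := fun x => ip (lim_op (delta s x) f) (U (s x)^-1%g f))).
- by move=> y; rewrite U_norm.
- move=> x; under eq_fun => y do
    rewrite deltaE UM U_ip UM (ipC hV) U_adj.
  exact: lim_opP.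
apply: (ultra_cvg_sqr (g := fun=> 0)
  (h := fun x => ip (lim_op (delta s x) f) f * ip f f)).
- move=> x; rewrite subr0; apply: le_trans (cauchy_schwarz hV _ _) _.
  by rewrite U_norm IHp //; exact: delta_based.
- by rewrite -(mul0r (ip f f)) -(Qf f); apply: cvgM => //; exact: cvg_cst.
- exact: cvg_cst.
Qed.

Lemma limit_sqr (a b d : T -> R) (al bl dl : R) : a @ p --> al -> b @ p --> bl ->
  d @ p --> dl -> (forall y, (a y - b y) ^+ 2 <= d y) -> (al - bl) ^+ 2 <= dl.
Proof.
move=> ha hb hd h; rewrite -subr_ge0.
have hc : (fun y => d y - (a y - b y) ^+ 2) @ p --> dl - (al - bl) ^+ 2.
  apply: cvgB => //; rewrite expr2; under eq_fun do rewrite expr2.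
  by apply: cvgM; apply: cvgB.
apply: ultra_cvg_ge hc; apply: (@filterS _ p _ setT) filterT => y _ /=.
by rewrite subr_ge0.
Qed.

(** As [delta s x y] almost fixes [f], the vectors [U (s (op x y)) f] and
    [U (s y) (U (s x) f)] have the same iterated limit; the first iterated limit
    is [lim_op s f] by idempotence, the second is [lim_op s (lim_op s f)]. *)
Lemma delta_fix s Q f : based_poly i s ->
  (forall f g, (fun x => ip (lim_op (delta s x) f) g) @ p --> ip (Q f) g) ->
  fixes Q f -> fixes (lim_op s) (lim_op s f).
Proof.
move=> Ks QP Qf v.
have lP x : exists l : R, (fun y => ip (U (s (op x y)) f) v) @ p --> l.
  by apply: (@ip_bounded_cvg _ _ _ hV _ p _ _ (ip f f)) => y; rewrite U_norm.
pose g x := projT1 (cid (lP x)).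
have gP x : (fun y => ip (U (s (op x y)) f) v) @ p --> g x.
  exact: projT2 (cid (lP x)).
apply: (@ultra_cvg_unique _ _ p _ g); last first.
  exact: idempotent_cvg pi (lim_opP s f v) gP.
apply: (ultra_cvg_sqr (g := fun x => ip (lim_op s (U (s x) f)) v)
  (h := fun x => (2 * ip f f - 2 * ip (lim_op (delta s x) f) f) * ip v v)).
- move=> x.
  apply: (limit_sqr (gP x) (lim_opP s (U (s x) f) v)
    (d := fun y => disp (delta s x) f y * ip v v)).
    by apply: cvgM; [exact: disp_cvg|exact: cvg_cst].
  by move=> y; rewrite deltaE mulgA -UM; exact: U_diff.
- have -> : (0 : R) = (2 * ip f f - 2 * ip (Q f) f) * ip v v.
    by rewrite Qf; ring.
  apply: cvgM; last exact: cvg_cst.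
  by apply: cvgB; [exact: cvg_cst|apply: cvgM => //; exact: cvg_cst].
- rewrite lim_op_adj; under eq_fun do rewrite lim_op_adj.
  exact: lim_opP.
Qed.

Lemma lim_op_isproj s : based_poly i s -> isproj (lim_op s).
Proof.
move=> Ks; have [Q Qp QP] := limit_projection (fun x => delta_based x Ks).
have EQ f g : ip (lim_op s f) g = ip (lim_op s (Q f)) g.
  rewrite -[f in LHS](subrK (Q f)) lim_opD (@delta_kill s Q) ?add0r //.
  by move=> h; rewrite (isproj_sym hV _ _ Qp) (ipBl hV) Qp
    (isproj_sym hV _ _ Qp) subrr.
apply: (contraction_isproj hV); [exact: lim_opD|exact: lim_opZ|exact: lim_op_le|] => f g.
rewrite lim_op_adj EQ -lim_op_adj (delta_fix Ks QP) -?EQ //.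
exact: (isproj_idem hV).
Qed.

Definition kappa s t x y := [~ s x, t y]%g.

Lemma kappa_based s t x : based_poly i s -> based_poly i t -> based_poly i.+1 (kappa s t x).
Proof.
move=> Ks [ht t1]; split; last by rewrite /kappa t1 commg1.
have h := polyR hF (poly_const op hF (based_poly_val x Ks)) ht.
by apply: (polyW hF _ h); exact: leq_addr.
Qed.

Lemma kappaE s t x y : (t y * (s x * kappa s t x y) = s x * t y)%g.
Proof. by rewrite /kappa; group_word. Qed.

(** On vectors fixed by the limit of [t], let [Q] be the limit of the projections
    of the [kappa s t x].  Where [Q] vanishes, so does the limit of [s], because
    conjugation by [t y] does not change [ip (U (s x) f) f] in the limit; where [Q]
    is the identity, [U (s x)] commutes with the limit of [t]. *)
Lemma lim_op_commuting s t : based_poly i s -> based_poly i t ->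
  (forall x, commuting (lim_op (kappa s t x)) (lim_op t)) -> commuting (lim_op s) (lim_op t).
Proof.
move=> Ks Kt kt.
have sp := lim_op_isproj Ks; have tp := lim_op_isproj Kt; have [IHp _] := IH.
have Kk x := kappa_based x Ks Kt.
have [Q Qp QP] := limit_projection Kk.
have Qt f : fixes (lim_op t) f -> fixes (lim_op t) (Q f).
  move=> ft g; rewrite (isproj_sym hV _ _ tp).
  apply: (uniq (QP f _)).
  have -> : (fun x => ip (lim_op (kappa s t x) f) (lim_op t g)) =
     fun x => ip (lim_op (kappa s t x) f) g.
    apply: funext => x; rewrite -(isproj_sym hV _ _ tp) -kt.
    by apply: (isproj_congr hV (IHp _ (Kk x))).
  exact: QP.
have kill f : fixes (lim_op t) f -> (forall g, ip (Q f) g = 0) ->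
    forall g, ip (lim_op s f) g = 0.
  move=> ft Qf; apply: (isproj_null hV sp).
  apply: (uniq (lim_opP s f f)).
  apply: (ultra_cvg_sqr (g := fun=> 0)
    (h := fun x => ip (lim_op (kappa s t x) f) f * ip f f)).
  - move=> x.
    have -> : ip (U (s x) f) f = ip (lim_op (kappa s t x) f) (U (s x)^-1%g f).
      have dt : (fun y => disp t f y * ip f f) @ p --> (0 : R).
        rewrite -(mul0r (ip f f)).
        by apply: cvgM; [exact/fixes_disp|exact: cvg_cst].
      apply/esym; apply: (uniq (lim_opP _ _ _)).
      apply: (ultra_cvg_sqr (g := fun y => ip (U (t y)^-1%g (U (s x) f)) f)
        (h := fun y => disp t f y * ip f f)) => //; last first.
        under eq_fun do rewrite U_adj invgK (ipC hV).
        by rewrite (ipC hV) -(ft (U (s x) f)); exact: lim_opP.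
      move=> y.
      have -> : ip (U (kappa s t x y) f) (U (s x)^-1%g f) =
          ip (U ((t y)^-1 * s x * t y)%g f) f.
        rewrite (ipC hV) U_adj invgK (ipC hV) -UM; congr (ip (U _ f) f).
        by rewrite /kappa; group_word.
      rewrite -UM; exact: U_diff.
    rewrite subr0; apply: le_trans (cauchy_schwarz hV _ _) _.
    by rewrite U_norm IHp.
  - by rewrite -(mul0r (ip f f)) -(Qf f); apply: cvgM => //; exact: cvg_cst.
  - exact: cvg_cst.
have fix_ f : fixes (lim_op t) f -> fixes Q f -> fixes (lim_op t) (lim_op s f).
  move=> ft Qf v; rewrite (isproj_sym hV _ _ tp).
  apply: (uniq (lim_opP s f _)).
  apply: (ultra_cvg_sqr (g := fun x => ip (U (s x) f) v)
    (h := fun x => (2 * ip f f - 2 * ip (lim_op (kappa s t x) f) f) * ip v v)).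
  - move=> x.
    have ha : (fun y => ip (U (t y) (U (s x) f)) v) @ p -->
        ip (U (s x) f) (lim_op t v).
      by rewrite -(isproj_sym hV _ _ tp); exact: lim_opP.
    have hb : (fun y => ip (U (s x) (U (t y) f)) v) @ p --> ip (U (s x) f) v.
      under eq_fun do rewrite U_adj.
      by rewrite U_adj -ft; exact: lim_opP.
    apply: (limit_sqr ha hb (d := fun y => disp (kappa s t x) f y * ip v v)).
      by apply: cvgM; [exact: disp_cvg|exact: cvg_cst].
    move=> y; rewrite -sqrrN opprB -!UM -kappaE mulgA; exact: U_diff.
  - have -> : (0 : R) = (2 * ip f f - 2 * ip (Q f) f) * ip v v.
      by rewrite Qf; ring.
    apply: cvgM; last exact: cvg_cst.
    by apply: cvgB; [exact: cvg_cst|apply: cvgM => //; exact: cvg_cst].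
  - exact: lim_opP.
have main f g : ip (lim_op t (lim_op s (lim_op t f))) g = ip (lim_op s (lim_op t f)) g.
  have ft := isproj_idem hV f tp; set h := lim_op t f in ft *.
  have sh : forall g, ip (lim_op s h) g = ip (lim_op s (Q h)) g.
    move=> g'; rewrite -[h in LHS](subrK (Q h)) lim_opD kill ?add0r // => w.
      by rewrite lim_opD -[- Q h]scaleN1r lim_opZ ft Qt // (ipDl hV) (ipZl hV).
    by rewrite (isproj_sym hV _ _ Qp) (ipBl hV) Qp (isproj_sym hV _ _ Qp) subrr.
  rewrite sh (isproj_congr hV tp sh); apply: fix_; first exact: Qt.
  exact: (isproj_idem hV).
have sw f g : ip (lim_op s (lim_op t f)) g = ip f (lim_op s (lim_op t g)).
  rewrite -main (isproj_sym hV _ g tp) (isproj_sym hV (lim_op t f) _ sp).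
  by rewrite (isproj_sym hV f _ tp) (ipC hV) main (ipC hV).
by move=> f g; rewrite sw (ipC hV) (isproj_sym hV (lim_op t g) f sp)
  (isproj_sym hV g _ tp) (ipC hV).
Qed.

(** Commutation with a map of the next level comes first, as the [kappa s t x] of
    two maps of the same level are of that kind. *)
Lemma good_level_step : good_level i.
Proof.
split=> [s|]; first exact: lim_op_isproj.
have [IHp IHc] := IH.
have half s t : based_poly i s -> based_poly i.+1 t -> commuting (lim_op s) (lim_op t).
  move=> Ks Kt; apply: lim_op_commuting => // [|x]; first exact: based_polyS.
  by apply: IHc => //; apply: kappa_based => //; exact: based_polyS.
move=> s t Ks Kt; apply: lim_op_commuting => // x f g.
by rewrite -half //; exact: kappa_based.
Qed.

End Step.

(** Levels beyond [m] contain only the trivial map, where the downward induction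
    starts. *)
Theorem polynomial_limit_isproj s : poly op F 0 s -> s one = 1%g ->
  isproj (lim_op s).
Proof.
move=> hs s1; suff [h _] : good_level 0 by apply: h.
suff : forall k i, (m <= i + k)%N -> good_level i by move=> /(_ m 0%N); apply.
elim=> [|k IHk] i mi; last by apply: good_level_step; apply: IHk; rewrite addSnnS.
have E1 t : based_poly i t -> forall f, fixes (lim_op t) f.
  move=> [ht _] f; suff -> : t = fun=> 1%g by exact: fixes_lim_op1.
  by apply: funext => y; apply: (Fm _ (poly_val ht y)); rewrite -[i]addn0.
split=> [t Kt f g|t t' Kt Kt' f g].
  by rewrite [LHS](ipC hV) (E1 t Kt g) (ipC hV).
by rewrite (E1 t) // !(E1 t') // (E1 t).
Qed.

End PolynomialLimits.

(** * Completion of an inner product space *)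

(** Limits along a fixed ultrafilter at infinity exist for bounded sequences, which
    makes the inner product of Cauchy sequences immediate to define. *)
Definition at_oo : set_system nat := projT1 (cid (ultraFilterLemma eventually_filter)).

#[global] Instance at_oo_ultra : UltraFilter at_oo.
Proof. by rewrite /at_oo; case: cid => /= W []. Qed.

Lemma at_oo_sub : at_oo --> \oo.
Proof. by rewrite /at_oo; case: cid => /= W []. Qed.

Lemma at_oo_ge N : at_oo [set n | (N <= n)%N].
Proof. by apply: at_oo_sub; exact: nbhs_infty_ge. Qed.

(** Structures are bundled so that the instances below depend on them alone. *)
Record form (R : realType) (X : lmodType R) := Form {
  form_fun :> X -> X -> R;
  formP : inner_product form_fun }.

Section Completion.
Variables (R : realType) (X : lmodType R) (B : form X).
Implicit Types (x y z : X) (u v w : nat -> X).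

Let bP := formP B.
Local Notation q x := (B x x).

Definition cauchy_seq u := forall e : R, 0 < e -> exists N : nat,
  forall n m, (N <= n)%N -> (N <= m)%N -> q (u n - u m) <= e.

Definition cauchy_pred : {pred nat -> X} := [pred u | `[< cauchy_seq u >]].

Lemma q_add x y : q (x + y) <= 2 * q x + 2 * q y.
Proof.
by have := ip_ge0 bP (x - y); rewrite (ipBB bP) (ipDD bP); lra.
Qed.

Lemma q_scale (a : R) x : q (a *: x) = a ^+ 2 * q x.
Proof. by rewrite (ipZl bP) (ipZr bP) expr2 mulrA. Qed.

Lemma q0 : q 0 = 0. Proof. exact: (ip0l bP). Qed.

Fact cauchy_submod : submod_closed cauchy_pred.
Proof.
split.
  apply/asboolP => e e0; exists 0%N => n m _ _.
  by rewrite subrr q0 ltW.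
move=> a u v /asboolP hu /asboolP hv; apply/asboolP => e e0.
pose c := 4 * (a ^+ 2 + 1).
have c0 : 0 < c by rewrite mulr_gt0 // ltr_wpDl // sqr_ge0.
have [N hN] := hu (e / c) (divr_gt0 e0 c0).
have [M hM] := hv (e / 4) (divr_gt0 e0 (@ltr0n R 4)).
exists (maxn N M) => n m; rewrite !geq_max => /andP[nN nM] /andP[mN mM].
have -> : (a *: u + v) n - (a *: u + v) m = a *: (u n - u m) + (v n - v m).
  by rewrite scalerBr opprD addrACA.
apply: le_trans (q_add _ _) _; rewrite q_scale.
have h1 := hN n m nN mN; have h2 := hM n m nM mM.
have h3 : c * q (u n - u m) <= e by rewrite mulrC -ler_pdivlMr.
have := ip_ge0 bP (u n - u m).
by move: h3 h2; rewrite /c; move: (q _) (q (v n - _)) (a ^+ 2) => s t r; lra.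
Qed.

HB.instance Definition _ :=
  GRing.isSubmodClosed.Build R (nat -> X) cauchy_pred cauchy_submod.

Record completion := Complete { cseq :> nat -> X; _ : cseq \in cauchy_pred }.

HB.instance Definition _ := [isSub for cseq].
HB.instance Definition _ := [Choice of completion by <:].
HB.instance Definition _ := [SubChoice_isSubLmodule of completion by <:].


Implicit Types (a b c : completion).

Lemma completionP a : cauchy_seq a.
Proof. by case: a => u /= /asboolP. Qed.

Definition complete u (hu : cauchy_seq u) : completion :=
  @Complete u (introT (asboolP _) hu).

Lemma completion_eq a b : (forall n, a n = b n) -> a = b.
Proof. by move=> ab; apply: val_inj; apply: funext. Qed.

Lemma completionD a b n : (a + b) n = a n + b n. Proof. by []. Qed.

Lemma completionZ (k : R) a n : (k *: a) n = k *: a n. Proof. by []. Qed.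

Lemma cauchy_bounded u : cauchy_seq u -> exists C, forall n, q (u n) <= C.
Proof.
move=> /(_ 1 ltr01)[N hN].
pose S := \sum_(k < N) q (u k).
have S0 : 0 <= S by apply: sumr_ge0 => k _; exact: (ip_ge0 bP).
exists (S + 2 * q (u N) + 2) => n.
have qN := ip_ge0 bP (u N).
have [nN|Nn] := ltnP n N.
  have : q (u n) <= S.
    rewrite /S (bigD1 (Ordinal nN)) //= lerDl.
    by apply: sumr_ge0 => k _; exact: (ip_ge0 bP).
  by lra.
have := hN n N Nn (leqnn N); have := q_add (u n - u N) (u N).
by rewrite subrK; lra.
Qed.

Definition cip a b : R := xget 0 [set l : R | (fun n => B (a n) (b n)) @ at_oo --> l].

Lemma cipP a b : (fun n => B (a n) (b n)) @ at_oo --> cip a b.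
Proof.
rewrite /cip; case: xgetP => [l -> //|none]; exfalso.
have [C hC] := cauchy_bounded (@completionP a).
have [D hD] := cauchy_bounded (@completionP b).
have [|l hl] := @ultra_bounded_cvg R nat at_oo _ (fun n => B (a n) (b n)) (C * D + 1).
  move=> n; apply: sqr_norm_le; apply: le_trans (cauchy_schwarz bP _ _) _.
  by apply: ler_pM => //; exact: (ip_ge0 bP).
exact: (none l).
Qed.
Local Arguments cipP : clear implicits.

Let uniq := @ultra_cvg_unique R nat at_oo at_oo_ultra.

Lemma cip_inner : inner_product cip.
Proof.
split=> [a b|a b c|k a b|a].
- apply: (uniq (cipP a b)); under eq_fun do rewrite (ipC bP).
  exact: cipP.
- apply: (uniq (cipP _ _)); under eq_fun do rewrite completionD (ipDl bP).
  by apply: cvgD; exact: cipP.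
- apply: (uniq (cipP _ _)); under eq_fun do rewrite completionZ (ipZl bP).
  by apply: cvgM; [exact: cvg_cst|exact: cipP].
- apply: (ultra_cvg_ge _ (cipP a a)).
  by apply: (@filterS _ at_oo _ setT) filterT => n _ /=; exact: (ip_ge0 bP).
Qed.

Lemma cauchy_const x : cauchy_seq (fun=> x).
Proof. by move=> e e0; exists 0%N => n m _ _; rewrite subrr q0 ltW. Qed.

Definition embed x : completion := complete (cauchy_const x).

Lemma cip_embed x y : cip (embed x) (embed y) = B x y.
Proof. by apply: (uniq (cipP _ _)); exact: cvg_cst. Qed.

Lemma embedD x y : embed (x + y) = embed x + embed y.
Proof. exact: completion_eq. Qed.

Lemma embedZ (k : R) x : embed (k *: x) = k *: embed x.
Proof. exact: completion_eq. Qed.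

Lemma embed_dense a (e : R) : 0 < e ->
  exists x, cip (a - embed x) (a - embed x) <= e.
Proof.
move=> e0; have [N hN] := @completionP a e e0.
exists (a N); apply: (ultra_cvg_le _ (cipP _ _)).
by apply: (@filterS _ at_oo) (at_oo_ge N) => n /= Nn; exact: hN.
Qed.

(** A minimising sequence of [J x = q x - 2 xi x] among the original vectors is
    Cauchy by the parallelogram law, and represents [xi]. *)
Lemma completion_hilbert : hilbert cip.
Proof.
split; first exact: cip_inner.
move=> xi C xiD xiZ xiC.
have cP := cip_inner.
pose J x := q x - 2 * xi (embed x).
have xiCx x : xi (embed x) ^+ 2 <= `|C| * q x.
  rewrite -cip_embed; apply: le_trans (xiC _) _.
  by rewrite ler_wpM2r ?ler_norm // (ip_ge0 cP).
have Jlow x : - `|C| <= J x.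
  have q0' := ip_ge0 bP x; have C0 := normr_ge0 C; have := xiCx x; rewrite /J.
  move: (xi _) (q x) q0' (`|C|) C0 => z b b0 c c0 h.
  have [h'|h'] := leP (2 * z) (b + c); first by lra.
  have := sqr_ge0 (b - c); rewrite !expr2 in h *.
  by nra.
pose j := inf [set J x | x in setT].
have Jinf : has_inf [set J x | x in setT].
  split; first by exists (J 0), 0.
  by exists (- `|C|) => _ [x _ <-]; exact: Jlow.
have Jj x : j <= J x by apply: ge_inf; [exact: Jinf.2|exists x].
have near n : {x | J x < j + n.+1%:R^-1}.
  apply: cid; have [|_ [x _ <-] Jx] := @inf_adherent _ _ n.+1%:R^-1 _ Jinf.
    by rewrite invr_gt0 ltr0n.
  by exists x.
pose xs n := projT1 (near n).
have xsP n : J (xs n) < j + n.+1%:R^-1 := projT2 (near n).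
have par x y : q (x - y) <= 2 * (J x - j) + 2 * (J y - j).
  have := Jj (2^-1 *: (x + y)).
  rewrite /J q_scale embedZ xiZ embedD xiD (ipDD bP) (ipBB bP) expr2.
  by lra.
have hxs : cauchy_seq xs.
  move=> e e0; exists (Num.truncn (4 / e)) => n m Nn Nm.
  have small k : (Num.truncn (4 / e) <= k)%N -> J (xs k) - j <= e / 4.
    move=> Nk; apply: ltW; rewrite ltrBlDl; apply: lt_trans (xsP k) _.
    rewrite ltrD2l -[e / 4]invf_div ltf_pV2 ?posrE ?ltr0n ?divr_gt0 //.
    by apply: lt_le_trans (truncnS_gt _) _; rewrite ler_nat.
  by apply: le_trans (par _ _) _; have := small n Nn; have := small m Nm; lra.
pose w := complete hxs; exists w.
have wx x : cip w (embed x) = xi (embed x).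
  suff : (cip w (embed x) - xi (embed x)) ^+ 2 <= 0 * q x.
    rewrite mul0r => h; apply/eqP; rewrite -subr_eq0 -sqrf_eq0.
    by rewrite eq_le h sqr_ge0.
  apply: discriminant => t; rewrite add0r.
  have h : (fun n => n.+1%:R^-1 + 2 * t * (B (xs n) x - xi (embed x)) +
      t ^+ 2 * q x) @ at_oo -->
      0 + 2 * t * (cip w (embed x) - xi (embed x)) + t ^+ 2 * q x.
    apply: cvgD; last exact: cvg_cst.
    apply: cvgD; last first.
      by apply: cvgM; [exact: cvg_cst|apply: cvgB; [exact: (cipP w (embed x))|exact: cvg_cst]].
    exact: (cvg_trans (cvg_app _ at_oo_sub) (@cvg_harmonic R)).
  rewrite add0r in h; apply: (ultra_cvg_ge _ h).
  apply: (@filterS _ at_oo _ setT) filterT => n _ /=.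
  have := Jj (xs n + t *: x); have := xsP n.
  rewrite /J embedD embedZ xiD xiZ (ipDD bP) (ipZr bP) q_scale.
  move: (B (xs n) (xs n)) (xi (embed (xs n))) n.+1%:R^-1 (B (xs n) x).
  by move: (xi (embed x)) (B x x) => b c d e f g; rewrite !mulrDr ?mulrN !mulrA; lra.
move=> v; apply/eqP; rewrite -subr_eq0 -sqrf_eq0 eq_le sqr_ge0 andbT.
have cw := ip_ge0 cP w.
pose D := 2 * (`|C| + cip w w) + 1.
have D0 : 0 < D by have := normr_ge0 C; rewrite /D; lra.
apply/ler_addgt0Pr => e e0; rewrite add0r.
have [x hx] := embed_dense v (divr_gt0 e0 D0).
have cvx := ip_ge0 cP (v - embed x).
have vE : v = (v - embed x) + embed x by rewrite subrK.
have -> : xi v - cip w v = xi (v - embed x) - cip w (v - embed x).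
  by rewrite (ipBr cP) wx {1}vE xiD; ring.
set r := v - embed x in hx cvx *.
have h1 : xi r ^+ 2 <= `|C| * cip r r.
  by apply: le_trans (xiC r) _; rewrite ler_wpM2r // ler_norm.
have h2 := cauchy_schwarz cP w r.
have h3 : D * cip r r <= e by rewrite mulrC -ler_pdivlMr.
have := sqr_ge0 (xi r + cip w r); rewrite /D in h3.
move: cvx h1 h2 h3; move: (xi r) (cip w r) (cip r r) (cip w w) (`|C|) => a b g d c.
by rewrite !expr2; lra.
Qed.

Lemma cauchy_isometry (phi : X -> X) u :
  (forall x y, phi (x - y) = phi x - phi y) ->
  (forall x, q (phi x) = q x) -> cauchy_seq u -> cauchy_seq (phi \o u).
Proof.
move=> phiB phi_iso hu e /hu[N hN]; exists N => n m Nn Nm.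
by rewrite /= -phiB phi_iso; exact: hN.
Qed.

End Completion.

Arguments cipP {R X B} a b.

(** * Densities along a sequence of finite sets *)

Section Limsup.
Variable R : realType.
Implicit Types u : nat -> R.

Lemma unit_bounded_fun u : (forall n, 0 <= u n <= 1) -> bounded_fun u.
Proof.
move=> u01; exists 1; split; first exact: num_real.
by move=> x x1 n _ /=; have /andP[a b] := u01 n; rewrite ger0_norm //; lra.
Qed.

Lemma sdrop_bounded u k : (forall n, 0 <= u n <= 1) -> has_sup (sdrop u k).
Proof.
move=> u01; split; first by exists (u k), k => //=.
by exists 1 => _ [n _ <-]; have /andP[] := u01 n.
Qed.

Lemma limn_sup_gt0 u : (forall n, 0 <= u n <= 1) -> 0 < limn_sup u ->
  exists2 eta, 0 < eta & forall k, exists2 n, (k <= n)%N & eta <= u n.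
Proof.
move=> u01 u0; exists (limn_sup u / 2) => [|k]; first by rewrite divr_gt0.
have le : limn_sup u <= sups u k.
  rewrite limn_supE; last exact: unit_bounded_fun.
  apply: ge_inf; last by exists k.
  exists 0 => _ [m _ <-]; have /andP[um _] := u01 m.
  by apply: le_trans um _; apply: ub_le_sup; [exact: (sdrop_bounded m u01).2|exists m => /=].
have [_ [n /= kn <-] h] := sup_adherent (divr_gt0 u0 (@ltr0n R 2)) (sdrop_bounded k u01).
by exists n => //; move: le h; rewrite /sups /=; lra.
Qed.

Lemma limn_sup_ge u (eta : R) : (forall n, 0 <= u n <= 1) ->
  (forall k, exists2 n, (k <= n)%N & eta <= u n) -> eta <= limn_sup u.
Proof.
move=> u01 h; rewrite limn_supE; last exact: unit_bounded_fun.
apply: lb_le_inf; first by exists (sups u 0%N), 0%N.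
move=> _ [k _ <-]; have [n kn un] := h k; apply: le_trans un _.
by apply: ub_le_sup; [exact: (sdrop_bounded k u01).2|exists n].
Qed.

End Limsup.

Section Counting.
Variables (R : realType) (T : choiceType).
Implicit Types (A B : {fset T}) (E : set T) (f : T -> R).

Lemma sum_fset_const A (c : R) : \sum_(x <- A) c = #|` A|%:R * c.
Proof. by rewrite big_const_seq count_predT iter_addr addr0 mulr_natl. Qed.

Lemma sum_fsetID A B f :
  \sum_(x <- A) f x = \sum_(x <- (A `&` B)%fset) f x + \sum_(x <- (A `\` B)%fset) f x.
Proof.
rewrite (big_fsetID _ (mem B)) /=; congr (_ + _).
  by apply: eq_fbigl => x; rewrite !inE.
by apply: eq_fbigl => x; rewrite !inE andbC.
Qed.

Lemma sum_fset_le A f (C : R) : (forall x, `|f x| <= C) ->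
  `|\sum_(x <- A) f x| <= #|` A|%:R * C.
Proof.
move=> fC; rewrite -sum_fset_const; apply: le_trans (ler_norm_sum _ _ _) _.
by apply: ler_sum => x _.
Qed.

Lemma sum_symdiff A B f (C : R) : (forall x, `|f x| <= C) ->
  `|\sum_(x <- A) f x - \sum_(x <- B) f x| <= #|` fset_symdiff A B|%:R * C.
Proof.
move=> fC; rewrite (sum_fsetID A B) (sum_fsetID B A) fsetIC opprD addrACA subrr.
rewrite add0r; apply: le_trans (ler_normB _ _) _.
have -> : #|` fset_symdiff A B| = (#|` (A `\` B)%fset| + #|` (B `\` A)%fset|)%N.
  rewrite -cardfsUI [X in (_ = _ + X)%N](_ : _ = 0%N) ?addn0 //.
  apply/eqP; rewrite cardfs_eq0; apply/eqP/fsetP => x; rewrite !inE.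
  by case: (x \in A); case: (x \in B).
by rewrite natrD mulrDl lerD // sum_fset_le.
Qed.

Lemma sum_image A f (phi : T -> T) : injective phi ->
  \sum_(x <- [fset phi x | x in A]%fset) f x = \sum_(x <- A) f (phi x).
Proof. by move=> inj; rewrite big_imfset //= => x y _ _ /inj. Qed.

Lemma card_sum A E :
  #|` [fset x in A | x \in E]%fset|%:R = \sum_(x <- A) (x \in E)%:R :> R.
Proof.
rewrite (big_fsetID _ (fun x => x \in E)) /= [X in _ + X]big_fset /=.
rewrite [X in _ + X]big1 ?addr0; last by move=> x /negPf ->.
rewrite -[LHS]mulr1 -sum_fset_const; rewrite !big_fset /=.
by apply: eq_bigr => x ->.
Qed.

End Counting.

(** * Invariant means and recurrence *)

Section Mean.
Variables (R : realType) (Gam : groupType).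
Implicit Types (f g : Gam -> R) (A : set Gam).

Definition bounded_map f := exists C, forall x, `|f x| <= C.

Record mean (mu : (Gam -> R) -> R) : Prop := Mean {
  meanD : forall f g, bounded_map f -> bounded_map g ->
    mu (fun x => f x + g x) = mu f + mu g;
  meanZ : forall a f, bounded_map f -> mu (fun x => a * f x) = a * mu f;
  mean_ge0 : forall f, bounded_map f -> (forall x, 0 <= f x) -> 0 <= mu f;
  mean1 : mu (fun=> 1) = 1;
  mean_inv : forall h f, bounded_map f -> mu (fun x => f (h * x)%g) = mu f }.

Definition ind A (x : Gam) : R := (x \in A)%:R.

Lemma bounded_ind A : bounded_map (ind A).
Proof. by exists 1 => x; rewrite /ind; case: (x \in A); rewrite ?normr0 ?normr1. Qed.

Lemma bounded_cst (c : R) : bounded_map (fun=> c).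
Proof. by exists `|c|. Qed.

Lemma bounded_mul f g : bounded_map f -> bounded_map g ->
  bounded_map (fun x => f x * g x).
Proof.
by move=> [C hC] [D hD]; exists (C * D) => x; rewrite normrM ler_pM.
Qed.

Lemma bounded_add f g : bounded_map f -> bounded_map g ->
  bounded_map (fun x => f x + g x).
Proof.
move=> [C hC] [D hD]; exists (C + D) => x.
by apply: le_trans (ler_normD _ _) _; exact: lerD.
Qed.

Lemma bounded_scale (a : R) f : bounded_map f -> bounded_map (fun x => a * f x).
Proof. exact: bounded_mul (bounded_cst a). Qed.

Lemma bounded_comp (phi : Gam -> Gam) f : bounded_map f ->
  bounded_map (fun x => f (phi x)).
Proof. by move=> [C hC]; exists C => x. Qed.

Variable mu : (Gam -> R) -> R.
Hypothesis hmu : mean mu.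

Lemma mean_le f g : bounded_map f -> bounded_map g -> (forall x, f x <= g x) ->
  mu f <= mu g.
Proof.
move=> bf bg fg.
have bN : bounded_map (fun x => -1 * f x) by exact: bounded_scale.
have := mean_ge0 hmu (bounded_add bg bN).
rewrite meanD // meanZ // mulN1r subr_ge0; apply => x.
by rewrite mulN1r subr_ge0.
Qed.

Lemma mean_cst (c : R) : mu (fun=> c) = c.
Proof.
have -> : (fun=> c) = (fun x : Gam => c * 1) by rewrite mulr1.
by rewrite meanZ ?mean1 ?mulr1 //; exact: bounded_cst.
Qed.

End Mean.

Arguments ind {R Gam} A x.

Section BoundedFunctions.
Variables (R : realType) (Gam : groupType).

Definition bounded_pred : {pred Gam -> R^o} :=
  [pred f | `[< bounded_map (f : Gam -> R) >]].

Fact bounded_submod : submod_closed bounded_pred.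
Proof.
split; first by apply/asboolP; exact: (@bounded_cst R Gam 0).
move=> a f g /asboolP bf /asboolP bg; apply/asboolP.
by apply: bounded_add => //; exact: bounded_scale.
Qed.

HB.instance Definition _ :=
  GRing.isSubmodClosed.Build R (Gam -> R^o) bounded_pred bounded_submod.

Record bfun := Bfun { bval :> Gam -> R^o; _ : bval \in bounded_pred }.

HB.instance Definition _ := [isSub for bval].
HB.instance Definition _ := [Choice of bfun by <:].
HB.instance Definition _ := [SubChoice_isSubLmodule of bfun by <:].

Lemma bfunP (f : bfun) : bounded_map (f : Gam -> R).
Proof. by case: f => f /= /asboolP. Qed.

Definition to_bfun (f : Gam -> R) (bf : bounded_map f) : bfun :=
  @Bfun f (introT (asboolP _) bf).

Lemma bfun_eq (f g : bfun) : (forall x, f x = g x) -> f = g.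
Proof. by move=> fg; apply: val_inj; apply: funext. Qed.

Lemma bfunD (f g : bfun) x : (f + g) x = f x + g x. Proof. by []. Qed.

Lemma bfunZ (a : R) (f : bfun) x : (a *: f) x = a * f x. Proof. by []. Qed.

Variable mu : (Gam -> R) -> R.
Hypothesis hmu : mean mu.

Definition mean_ip (f g : bfun) : R := mu (fun x => f x * g x).

Lemma mean_inner : inner_product mean_ip.
Proof.
split=> [f g|f g k|a f g|f]; rewrite /mean_ip.
- by congr mu; apply: funext => x; rewrite mulrC.
- rewrite -meanD //; try by apply: bounded_mul; exact: bfunP.
  by congr mu; apply: funext => x; rewrite bfunD mulrDl.
- rewrite -meanZ //; last by apply: bounded_mul; exact: bfunP.
  by congr mu; apply: funext => x; rewrite bfunZ mulrA.
- apply: (mean_ge0 hmu); first by apply: bounded_mul; exact: bfunP.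
  by move=> x; rewrite -expr2 sqr_ge0.
Qed.

Definition mean_form : form bfun := Form mean_inner.

Definition translate (h : Gam) (f : bfun) : bfun :=
  to_bfun (bounded_comp (fun x => h^-1 * x)%g (bfunP f)).

Lemma translate_ip h f g : mean_ip (translate h f) (translate h g) = mean_ip f g.
Proof.
rewrite -[RHS](@mean_inv _ _ _ hmu h^-1%g) //.
by apply: bounded_mul; exact: bfunP.
Qed.

Lemma translateB h f g : translate h (f - g) = translate h f - translate h g.
Proof. exact: bfun_eq. Qed.

Lemma translateD h f g : translate h (f + g) = translate h f + translate h g.
Proof. exact: bfun_eq. Qed.

Lemma translateZ h (a : R) f : translate h (a *: f) = a *: translate h f.
Proof. exact: bfun_eq. Qed.

Definition ctranslate h (a : completion mean_form) : completion mean_form :=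
  complete (cauchy_isometry (B := mean_form) (translateB h)
    (fun f => translate_ip h f f) (@completionP _ _ _ a)).

Notation ip := (cip (B := mean_form)).

Lemma ctranslate_ip h a b : ip (ctranslate h a) (ctranslate h b) = ip a b.
Proof.
have e : (fun n => mean_form (ctranslate h a n) (ctranslate h b n)) =
    fun n => mean_form (a n) (b n).
  by apply: funext => n; exact: translate_ip.
by rewrite /cip e.
Qed.

End BoundedFunctions.

Section Subfiltration.
Local Open Scope group_scope.
Variables (T : Type) (op : T -> T -> T) (Gam : groupType) (F : nat -> set Gam).

Lemma filtrationI K : subgroup K -> filtration F ->
  filtration (fun i => K `&` F i).
Proof.
move=> [K1 KM KV] hF; split.
- by move=> i; split => //; exact: (fil1 hF).
- by move=> i x y [Kx Fx] [Ky Fy]; split; [exact: KM|exact: (filM hF)].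
- by move=> i x [Kx Fx]; split; [exact: KV|exact: (filV hF)].
- by move=> i x [Kx Fx]; split => //; exact: (filS hF).
- move=> i j x y [Kx Fx] [Ky Fy]; split; last exact: (filR hF).
  by rewrite commgE'; do !apply: (KM) => //; exact: KV.
Qed.

Lemma polyI K i (s : T -> Gam) : subgroup K -> poly op F i s ->
  (forall y, K (s y)) -> poly op (fun i => K `&` F i) i s.
Proof.
move=> [_ KM KV] hs Ks n; elim: n i s hs Ks => [|n IH] i s hs Ks.
  by split => // y; split => //; exact: poly_val hs y.
split=> [y|x]; first by split => //; exact: poly_val hs y.
apply: IH; first exact: poly_der.
by move=> y; apply: KM => //; exact: KV.
Qed.

End Subfiltration.

Section Recurrence.
Variables (R : realType) (T : eqType) (op : T -> T -> T) (one : T) (XT : seq T).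
Variables (p : set_system T).
Hypothesis opA : associative op.
Hypothesis op1l : left_id one op.
Hypothesis op1r : right_id one op.
Hypothesis genXT : forall P : set T, P one ->
  (forall x y, x \in XT -> P y -> P (op x y)) -> forall y, P y.
Context {pU : UltraFilter p}.
Hypothesis pi : p `<=` fprod op p p.
Variables (Gam : groupType) (F : nat -> set Gam) (m : nat).
Hypothesis hF : filtration F.
Hypothesis Fm : forall i, (m <= i)%N -> F i `<=` [set 1%g].
Variable mu : (Gam -> R) -> R.
Hypothesis hmu : mean mu.
Variables (r : T -> Gam) (A : set Gam).
Hypothesis hr : poly op F 0 r.
Hypothesis r1 : r one = 1%g.

(** The weak limit of the translates of the indicator [f] of [A] is the
    projection of [f] to a space that contains the constants, whence the lower
    bound by the square of the mean of [f]. *)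
Theorem mean_recurrence (c : R) : c < mu (ind A) ^+ 2 ->
  p [set b | c <= mu (fun x => ind A ((r b)^-1 * x)%g * ind A x)].
Proof.
move=> ca.
pose X := [seq r y | y <- words op one XT m].
have KX := @gen_subgroup _ X.
(* The group is cut down to the one generated by the values of [r], which is
   finitely generated although [Gam] is not. *)
have rX y : gen X (r y).
  apply: (poly_gen (n := m) genXT Fm KX hr) => [|{}y yw]; first exact: leq_addl.
  by apply: mem_gen; exact: map_f.
pose F' i := gen X `&` F i.
have hF' : filtration F' by exact: filtrationI.
have hr' : poly op F' 0 r by exact: polyI.
have Fm' i : (m <= i)%N -> F' i `<=` [set 1%g].
  by move=> mi x [_]; exact: Fm.
have FX' x : x \in X -> F' 1%N x.
  case/mapP => y _ ->.
  have -> : r y = der op y r one by rewrite /der r1 op1r invg1 mul1g.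
  exact: poly_val (poly_der y hr') one.
have FgenX i x : F' i x -> gen X x by case.
pose V := completion (mean_form hmu); pose ip := cip (B := mean_form hmu).
have hV : hilbert ip by exact: completion_hilbert.
pose U := @ctranslate R Gam mu hmu.
have UD h (u v : V) : U h (u + v) = U h u + U h v.
  by apply: completion_eq => n; exact: translateD.
have UZ h a (u : V) : U h (a *: u) = a *: U h u.
  by apply: completion_eq => n; exact: translateZ.
have U_ip h (u v : V) : ip (U h u) (U h v) = ip u v by exact: ctranslate_ip.
have UM h k (u : V) : U (h * k)%g u = U h (U k u).
  apply: completion_eq => n; apply: bfun_eq => x /=.
  by rewrite invgM mulgA.
have U1 (u : V) : U 1%g u = u.
  by apply: completion_eq => n; apply: bfun_eq => x /=; rewrite invg1 mul1g.
pose Er := lim_op ip p U r.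
have Ep : isproj ip Er.
  exact: (polynomial_limit_isproj hV opA op1l op1r genXT pi hF' Fm' FX' FgenX
    UD UZ U_ip UM U1 hr' r1).
have EP u v : (fun y => ip (U (r y) u) v) @ p --> ip (Er u) v.
  exact: (lim_opP hV U_ip).
pose f : V := embed _ (to_bfun (@bounded_ind R Gam A)).
pose e : V := embed _ (to_bfun (@bounded_cst R Gam 1)).
have ee : ip e e = 1.
  rewrite /ip /e cip_embed /= /mean_ip /= -[RHS](mean1 hmu).
  by congr mu; apply: funext => x; rewrite mulr1.
have fe : ip f e = mu (ind A).
  rewrite /ip /e cip_embed /= /mean_ip /=.
  by congr mu; apply: funext => x; rewrite mulr1.
have Ue h : U h e = e by apply: completion_eq => n; exact: bfun_eq.
have Ufe : ip (Er f) e = mu (ind A).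
  apply: (ultra_cvg_unique (EP f e)).
  by under eq_fun => y do rewrite -{1}(Ue (r y)) U_ip fe; exact: cvg_cst.
have Eff : mu (ind A) ^+ 2 <= ip (Er f) f.
  by rewrite -Ufe -(Ep f f) -[X in _ <= X]mulr1 -ee; exact: (cauchy_schwarz hV).
have ineq : 0 < ip (Er f) f - c by rewrite subr_gt0; exact: lt_le_trans Eff.
have : p [set b | `|ip (U (r b) f) f - ip (Er f) f| < ip (Er f) f - c].
  exact: ultra_cvg_dist.
apply: (@filterS _ p) => b /=; rewrite ltr_norml => /andP[h _].
have -> : mu (fun x => ind A ((r b)^-1 * x)%g * ind A x) = ip (U (r b) f) f.
  have -> : U (r b) f = embed _ (translate (r b) (to_bfun (@bounded_ind R Gam A))).
    by apply: completion_eq.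
  by rewrite /ip cip_embed.
by lra.
Qed.

End Recurrence.

(** * Averages along a Folner sequence *)

Section Averages.
Variables (R : realType) (G : groupType) (F : nat -> {fset G}).
Hypothesis F0 : forall N, F N != fset0.
Implicit Types (f : G -> R) (E : set G).

Definition avg f N : R := (\sum_(x <- F N) f x) / #|` F N|%:R.

Lemma card_gt0 N : 0 < #|` F N|%:R :> R.
Proof. by rewrite ltr0n cardfs_gt0. Qed.

Lemma avgD f (g : G -> R) N : avg (fun x => f x + g x) N = avg f N + avg g N.
Proof. by rewrite /avg big_split mulrDl. Qed.

Lemma avgZ (a : R) f N : avg (fun x => a * f x) N = a * avg f N.
Proof. by rewrite /avg -mulr_sumr mulrA. Qed.

Lemma avg_le f (g : G -> R) N : (forall x, f x <= g x) -> avg f N <= avg g N.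
Proof.
by move=> fg; rewrite ler_pM2r ?invr_gt0 ?card_gt0 //; apply: ler_sum => x _.
Qed.

Lemma avg_cst (c : R) N : avg (fun=> c) N = c.
Proof. by rewrite /avg sum_fset_const mulrAC divff ?mul1r // gt_eqF ?card_gt0. Qed.

Lemma avg_norm f N (C : R) : (forall x, `|f x| <= C) -> `|avg f N| <= C.
Proof.
move=> fC; have lo := avg_cst (- C) N; have up := avg_cst C N.
rewrite ler_norml; apply/andP; split; [rewrite -lo|rewrite -[X in _ <= X]up].
  all: by apply: avg_le => x; have := fC x; rewrite ler_norml => /andP[].
Qed.

Lemma avg_ind E N : 0 <= avg (ind E) N <= 1.
Proof.
apply/andP; split; [rewrite -(avg_cst 0 N)|rewrite -[X in _ <= X](avg_cst 1 N)].
  all: by apply: avg_le => x; rewrite /ind; case: (x \in E).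
Qed.

Lemma upper_densityE E : upper_density R F E = limn_sup (avg (ind E)).
Proof.
rewrite /upper_density; congr limn_sup; apply: funext => N.
by rewrite card_sum.
Qed.

Lemma avg_shift (phi : G -> G) f N (C : R) : injective phi ->
  (forall x, `|f x| <= C) ->
  `|avg (fun x => f (phi x)) N - avg f N| <=
  C * (#|` fset_symdiff [fset phi x | x in F N]%fset (F N)|%:R / #|` F N|%:R).
Proof.
move=> inj fC; rewrite /avg -mulrBl normrM normfV (ger0_norm (ltW (card_gt0 N))).
rewrite mulrA ler_pM2r ?invr_gt0 ?card_gt0 // -(sum_image _ _ inj) mulrC.
exact: sum_symdiff.
Qed.

Lemma not_cvg0_frequently E : ~ (avg (ind E) @ \oo --> (0 : R)) ->
  exists2 eta, 0 < eta & forall k, exists2 n, (k <= n)%N & eta <= avg (ind E) n.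
Proof.
move=> h; apply: contrapT => none; apply: h; apply/cvgrPdist_lt => e e0.
have [k hk] : exists k, forall n, (k <= n)%N -> avg (ind E) n < e.
  apply: contrapT => hk; apply: none; exists e => // k.
  apply: contrapT => hn; apply: hk; exists k => n kn.
  by rewrite ltNge; apply/negP => en; apply: hn; exists n.
exists k => // n /= kn; rewrite sub0r normrN ger0_norm ?hk //.
by have /andP[] := avg_ind E n.
Qed.

Section Invariance.
Variable op : G -> G -> G.
Hypothesis op_inj : forall g, injective (op g).
Hypothesis op_folner : forall g : G,
  (fun N => #|` fset_symdiff [fset op g x | x in F N]%fset (F N)|%:R
            / #|` F N|%:R : R) @ \oo --> (0 : R).

Lemma avg_shift_cvg (g : G) f : bounded_map f ->
  (fun N => `|avg (fun x => f (op g x)) N - avg f N|) @ \oo --> (0 : R).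
Proof.
move=> [C fC]; apply: (squeeze0 (g := fun N => C *
  (#|` fset_symdiff [fset op g x | x in F N]%fset (F N)|%:R / #|` F N|%:R))).
  by move=> N; rewrite normr_ge0 avg_shift.
rewrite -(mulr0 C); apply: cvgM; first exact: cvg_cst.
exact: op_folner.
Qed.

(** An ultrafilter that contains this filter has only members of positive upper
    density. *)
Definition full_density : set_system G :=
  [set X | avg (ind (~` X)) @ \oo --> (0 : R)].

(** All translates of a set of full density have full density. *)
Lemma full_density_subidempotent : subidempotent op full_density.
Proof.
split.
  apply: Build_ProperFilter_ex => [X hX|].
    apply: contrapT => nX.
    have e : avg (ind (~` X)) = fun=> 1.
      apply: funext => N; rewrite -[RHS](avg_cst 1 N); congr avg.
      apply: funext => x; rewrite /ind mem_set // => Xx.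
      by apply: nX; exists x.
    rewrite /full_density /= e in hX.
    have h : (1 : R) = 0 by apply: (cvg_unique _ _ hX) => //; exact: cvg_cst.
    by have := @oner_neq0 R; rewrite h eqxx.
  split; rewrite /full_density /=.
  - have -> : avg (ind (~` setT)) = fun=> 0.
      apply: funext => N; rewrite -[RHS](avg_cst 0 N); congr avg.
      by apply: funext => x; rewrite /ind memNset // => /(_ I).
    exact: cvg_cst.
  - move=> X Y hX hY.
    apply: (squeeze0 (g := fun N => avg (ind (~` X)) N + avg (ind (~` Y)) N)).
      move=> N; have /andP[-> _] := avg_ind (~` (X `&` Y)) N.
      rewrite -avgD; apply: avg_le => x.
      rewrite /ind setCI in_setU.
      by case: (x \in ~` X); case: (x \in ~` Y); rewrite /= ?addr0 ?add0r ?lerDl ?ler01.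
    by rewrite -(addr0 0); exact: cvgD.
  - move=> X Y XY; apply: squeeze0 => N.
    have /andP[-> _] := avg_ind (~` Y) N; apply: avg_le => x.
    rewrite /ind; have [h|h] := pselect ((~` Y) x); last by rewrite (memNset h).
    have h' : (~` X) x by move=> /XY.
    by rewrite !mem_set.
move=> X hX; rewrite /fprod /=.
suff h x : full_density [set y | X (op x y)].
  rewrite (_ : [set x | _] = setT); last first.
    by apply/seteqP; split => x // _; exact: h.
  rewrite /full_density /=.
  have -> : avg (ind (~` setT)) = fun=> 0.
    apply: funext => N; rewrite -[RHS](avg_cst 0 N); congr avg.
    by apply: funext => y; rewrite /ind memNset // => /(_ I).
  exact: cvg_cst.
have hs := avg_shift_cvg x (bounded_ind R (~` X)).
apply: (squeeze0 (g := fun N => `|avg (fun y => ind (~` X) (op x y)) N -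
  avg (ind (~` X)) N| + avg (ind (~` X)) N)); last first.
  by rewrite -(addr0 0); exact: cvgD.
move=> N; have /andP[-> _] := avg_ind (~` [set y | X (op x y)]) N.
have -> : avg (ind (~` [set y | X (op x y)])) N =
    avg (fun y => ind (~` X) (op x y)) N by [].
by rewrite -lerBlDr ler_norm.
Qed.

End Invariance.
End Averages.

(** The mean is the limit of the averages along an ultrafilter that lives on the
    indices [ns k], where [A] has density at least [eta]. *)
Lemma folner_mean (R : realType) (G : groupType) (F : nat -> {fset G}) (A : set G) :
  left_folner R F -> 0 < upper_density R F A ->
  exists2 mu : (G -> R) -> R, mean mu & 0 < mu (ind A).
Proof.
move=> [F0 Ff]; rewrite upper_densityE => /(limn_sup_gt0 (@avg_ind R G F F0 A))[eta eta0 h].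
pose ns k := projT1 (cid2 (h k)).
have nsk k : (k <= ns k)%N by rewrite /ns; case: cid2.
have nsA k : eta <= avg F (ind A) (ns k) by rewrite /ns; case: cid2.
pose mu f : R := xget 0 [set l : R | (fun k => avg F f (ns k)) @ at_oo --> l].
have muP f : bounded_map f -> (fun k => avg F f (ns k)) @ at_oo --> mu f.
  move=> [C fC]; rewrite /mu; case: xgetP => [l -> //|none]; exfalso.
  have [|l hl] := @ultra_bounded_cvg R nat at_oo _ (fun k => avg F f (ns k)) C.
    by move=> k; exact: (@avg_norm R G F F0).
  exact: (none l).
have uniq := @ultra_cvg_unique R nat at_oo at_oo_ultra.
have ns_oo : ns @ at_oo --> \oo.
  apply: (cvg_trans (cvg_app ns at_oo_sub)) => S [n _ nS].
  by exists n => // k nk; apply: nS; exact: leq_trans (nsk k).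
exists mu; last first.
  apply: lt_le_trans eta0 _; apply: (ultra_cvg_ge _ (muP _ (bounded_ind R A))).
  by apply: (@filterS _ at_oo _ setT) filterT => k _ /=.
split=> [f g bf bg|a f bf|f bf f0||g f bf].
- apply: (uniq _ _ _ (muP _ (bounded_add bf bg))).
  under eq_fun do rewrite avgD.
  by apply: cvgD; exact: muP.
- apply: (uniq _ _ _ (muP _ (bounded_scale a bf))).
  under eq_fun do rewrite avgZ.
  by apply: cvgM; [exact: cvg_cst|exact: muP].
- apply: (ultra_cvg_ge _ (muP _ bf)).
  apply: (@filterS _ at_oo _ setT) filterT => k _ /=.
  by rewrite -(avg_cst F0 0 (ns k)); exact: avg_le.
- apply: (uniq _ _ _ (muP _ (bounded_cst G 1))).
  under eq_fun do rewrite avg_cst //.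
  exact: cvg_cst.
- have inj : injective (fun x : G => g * x)%g by exact: mulgI.
  have hs := @avg_shift_cvg R G F F0 (fun g x => g * x)%g (@mulgI G) Ff g f bf.
  have h1 : (fun k => `|avg F (fun x => f (g * x)%g) (ns k) - avg F f (ns k)|)
      @ at_oo --> (0 : R).
    exact: (cvg_comp _ _ ns_oo hs).
  apply: (uniq _ _ _ (muP _ (bounded_comp (fun x => g * x)%g bf))).
  apply: (ultra_cvg_sqr (g := fun k => avg F f (ns k))
    (h := fun k => `|avg F (fun x => f (g * x)%g) (ns k) - avg F f (ns k)| *
                   `|avg F (fun x => f (g * x)%g) (ns k) - avg F f (ns k)|)).
  + by move=> k; rewrite -expr2 real_normK ?num_real.
  + by rewrite -(mulr0 0); exact: cvgM.
  + exact: muP.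
Qed.

(** * Intersectivity *)

Section Intersectivity.
Variables (R : realType) (Gam : groupType) (mu : (Gam -> R) -> R).
Hypothesis hmu : mean mu.
Implicit Types (S : set Gam).

Notation "'m(' S )" := (mu (ind S)) (format "'m(' S )").

Lemma mean_sum (I : Type) (s : seq I) (f : I -> Gam -> R) :
  (forall i, bounded_map (f i)) ->
  bounded_map (fun x => \sum_(i <- s) f i x) /\
  mu (fun x => \sum_(i <- s) f i x) = \sum_(i <- s) mu (f i).
Proof.
move=> bf; elim: s => [|i s [IHb IH]].
  under eq_fun do rewrite big_nil; rewrite big_nil mean_cst //.
  by split => //; exact: bounded_cst.
under eq_fun do rewrite big_cons; rewrite big_cons.
by split; [exact: bounded_add|rewrite meanD // IH].
Qed.

Lemma meas_le S S' : S `<=` S' -> m(S) <= m(S').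
Proof.
move=> SS'; apply: (mean_le hmu); try exact: bounded_ind.
move=> x; rewrite /ind; have [Sx|nSx] := pselect (S x).
  by rewrite !mem_set //; exact: SS'.
by rewrite (memNset nSx).
Qed.

Lemma meas_le1 S : m(S) <= 1.
Proof.
rewrite -(mean1 hmu); apply: (mean_le hmu); [exact: bounded_ind|exact: bounded_cst|].
by move=> x; rewrite /ind; case: (x \in S).
Qed.

Lemma meas_diff S S' : S' `<=` S -> m(S `\` S') = m(S) - m(S').
Proof.
move=> SS'; apply/eqP; rewrite eq_sym subr_eq -(meanD hmu); try exact: bounded_ind.
apply/eqP; congr mu; apply: funext => x; rewrite /ind in_setD.
have [h|h] := boolP (x \in S'); last by rewrite andbT addr0.
by rewrite andbF add0r (mem_set (SS' _ (set_mem h))).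
Qed.

(** Set [T m n] to be the union of the [S N] for [m <= N < n].  For each [m] choose
    [n] so that [T m n] nearly exhausts the union of all later [S N]; then finitely
    many of the chosen [T m n] lose together at most half of the measure of a
    single [S N], so they meet. *)
Lemma meas_limsup (S : nat -> set Gam) (c : R) : 0 < c ->
  (forall k, exists2 N, (k <= N)%N & c <= m(S N)) ->
  exists (x : nat -> Gam) (n : nat -> nat),
    forall M k, (k <= M)%N -> exists N, [/\ (k <= N)%N, (N < n k)%N & S N (x M)].
Proof.
move=> c0 hS.
pose T k n := [set x | exists N, [/\ (k <= N)%N, (N < n)%N & S N x]].
have Tle k n n' : (n <= n')%N -> T k n `<=` T k n'.
  by move=> nn' x [N [kN Nn SN]]; exists N; split => //; exact: leq_trans nn'.
pose v k := [set m(T k n) | n in setT].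
have vs k : has_sup (v k).
  split; first by exists m(T k 0%N), 0%N.
  by exists 1 => _ [n _ <-]; exact: meas_le1.
pose e k : R := c / 2 ^+ k.+2.
have e0 k : 0 < e k by rewrite divr_gt0 // exprn_gt0.
have pick k : {n | sup (v k) - e k < m(T k n)}.
  apply: cid; have [_ [n _ <-] h] := sup_adherent (e0 k) (vs k).
  by exists n.
pose n k := projT1 (pick k).
have nP k : sup (v k) - e k < m(T k (n k)) := projT2 (pick k).
have loss k n' : (n k <= n')%N -> m(T k n' `\` T k (n k)) <= e k.
  move=> kn'; rewrite meas_diff; last exact: Tle.
  have : m(T k n') <= sup (v k).
    by apply: ub_le_sup; [exact: (vs k).2|exists n'].
  by have := nP k; lra.
have esum M : \sum_(k < M) e k = c / 2 - c / 2 ^+ M.+1.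
  elim: M => [|M IH]; first by rewrite big_ord0 expr1 subrr.
  rewrite big_ord_recr /= IH /e !exprS; field.
  by rewrite expf_neq0.
have ex M : exists x, forall k, (k <= M)%N -> T k (n k) x.
  apply: contrapT => none.
  have [N MN cN] := hS M.
  pose n' := (maxn N.+1 (\max_(k < M.+1) n k))%N.
  have nn' k : (k <= M)%N -> (n k <= n')%N.
    rewrite -ltnS => kM; rewrite leq_max; apply/orP; right.
    exact: (@leq_bigmax _ (fun k : 'I_M.+1 => n k) (Ordinal kM)).
  have cT : c <= m(T M n').
    apply: le_trans cN _; apply: meas_le => x Sx; exists N; split => //.
    by rewrite leq_max ltnSn.
  pose D (k : 'I_M.+1) := T k n' `\` T k (n k).
  have [bD mD] := @mean_sum _ (index_enum 'I_M.+1) (fun k => ind (D k))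
    (fun k => bounded_ind R (D k)).
  have : m(T M n') <= \sum_(k < M.+1) m(D k).
    rewrite -mD; apply: (mean_le hmu) => //; first exact: bounded_ind.
    move=> x; rewrite /ind; have [Tx|nTx] := pselect (T M n' x); last first.
      by rewrite (memNset nTx); apply: sumr_ge0.
    rewrite (mem_set Tx).
    have [k kM nTk] : exists2 k, (k <= M)%N & ~ T k (n k) x.
      apply: contrapT => h; apply: none; exists x => k kM.
      by apply: contrapT => h'; apply: h; exists k.
    have kM' : (k < M.+1)%N by [].
    rewrite (bigD1 (Ordinal kM')) //= mem_set.
      by rewrite lerDl; apply: sumr_ge0.
    split => //=; have [N' [MN' N'n SN']] := Tx.
    by exists N'; split => //; exact: leq_trans MN'.
  apply/negP; rewrite -ltNge; apply: lt_le_trans cT.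
  apply: (@le_lt_trans _ _ (\sum_(k < M.+1) e k)).
    by apply: ler_sum => k _; apply: loss; apply: nn'; rewrite -ltnS.
  rewrite esum; have : 0 < c / 2 ^+ M.+2 by rewrite divr_gt0 // exprn_gt0.
  by lra.
exists (fun M => projT1 (cid (ex M))), n => M k kM.
by case: cid => x /= /(_ k kM).
Qed.

Lemma at_oo_exists n (P : nat -> set nat) :
  at_oo [set M | exists2 N, (N < n)%N & P N M] ->
  exists2 N, (N < n)%N & at_oo (P N).
Proof.
elim: n => [|n IH] h.
  by have /filter_ex[M [N]] := h.
have [hn|hn] := in_ultra_setVsetC (P n) at_oo_ultra; first by exists n.
have [|N Nn PN] := IH; last by exists N => //; exact: ltnW.
apply: (@filterS _ at_oo) (filterI h hn) => M /= [[N Nn PNM] nPn].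
exists N => //; move: Nn; rewrite ltnS leq_eqVlt => /predU1P[Nn|//].
by rewrite Nn in PNM.
Qed.

Variables (G : groupType) (F : nat -> {fset G}).
Hypothesis F0 : forall N, F N != fset0.

(** Bergelson's intersectivity lemma for a finitely additive mean.  By averaging,
    the set of points that lie in many of the [E b] with [b] in [F N] has measure
    at least [c'] for infinitely many [N]; [meas_limsup] gives a sequence of points
    approximating a point that has this property for infinitely many [N] at once,
    and [B] is its itinerary, read off along an ultrafilter. *)
Lemma intersectivity (E : G -> set Gam) (c eta : R) (J : set G) :
  0 < c -> 0 < eta -> (forall b, J b -> c <= m(E b)) ->
  (forall k, exists2 N, (k <= N)%N & eta <= avg F (ind J) N) ->
  exists2 B : set G, 0 < upper_density R F B &
    forall b b', B b -> B b' -> exists2 x, E b x & E b' x.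
Proof.
move=> c0 eta0 hJ hF.
pose g N x : R := avg F (fun b => ind (E b) x) N.
pose c' := eta * c / 2.
have ec0 : 0 < eta * c by rewrite mulr_gt0.
have c'0 : 0 < c' by rewrite divr_gt0.
pose S N := [set x | c' <= g N x].
have g01 N x : 0 <= g N x <= 1.
  rewrite /g; apply/andP; split.
    rewrite -(avg_cst F0 0 N); apply: (avg_le F0) => b.
    by rewrite /ind ler0n.
  rewrite -[X in _ <= X](avg_cst F0 1 N); apply: (avg_le F0) => b.
  by rewrite /ind; case: (x \in E b).
have bg N : bounded_map (g N).
  by exists 1 => x; have /andP[a b] := g01 N x; rewrite ger0_norm.
have gmean N : mu (g N) = avg F (fun b => m(E b)) N.
  have [bs ms] := @mean_sum _ (F N : seq G) (fun b => ind (E b))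
    (fun b => bounded_ind R (E b)).
  rewrite /avg -ms mulrC -(meanZ hmu) //; congr mu.
  by apply: funext => x; rewrite /g /avg mulrC.
have mS N : eta <= avg F (ind J) N -> c' <= m(S N).
  move=> hN.
  have h1 : eta * c <= mu (g N).
    rewrite gmean; apply: (@le_trans _ _ (avg F (fun b => c * ind J b) N)).
      by rewrite avgZ mulrC ler_pM2l.
    apply: (avg_le F0) => b; rewrite /ind; have [Jb|nJb] := pselect (J b).
      by rewrite mem_set // mulr1; exact: hJ.
    rewrite memNset // mulr0; apply: (mean_ge0 hmu); first exact: bounded_ind.
    by move=> x; rewrite /ind ler0n.
  have h2 : mu (g N) <= m(S N) + c'.
    rewrite -[X in _ + X](mean_cst hmu) -(meanD hmu) //;
      [|exact: bounded_ind|exact: bounded_cst].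
    apply: (mean_le hmu) => //.
      by apply: bounded_add; [exact: bounded_ind|exact: bounded_cst].
    move=> x; rewrite /ind; have [Sx|nSx] := pselect (S N x).
      rewrite mem_set // -[g N x]addr0; have /andP[_ h] := g01 N x.
      by apply: lerD => //; exact: ltW.
    by rewrite memNset // add0r ltW // ltNge; apply/negP.
  by move: h1 h2; rewrite /c'; lra.
have [|x [n hx]] := @meas_limsup S c' c'0.
  by move=> k; have [N kN hN] := hF k; exists N => //; exact: mS.
pose B := [set b | at_oo [set M | E b (x M)]].
exists B; last first.
  by move=> b b' hb hb'; have [M [hM hM']] := ultra_meet hb hb'; exists (x M).
rewrite upper_densityE; apply: (lt_le_trans c'0).
apply: limn_sup_ge => [N|k]; first exact: avg_ind.
have [N Nn [kN hN]] : exists2 N, (N < n k)%N & (k <= N)%N /\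
    at_oo [set M | S N (x M)].
  have [|N Nn hN] := @at_oo_exists (n k)
      (fun N => [set M | (k <= N)%N /\ S N (x M)]).
    apply: (@filterS _ at_oo) (at_oo_ge k) => M /= kM.
    by have [N [kN Nn SN]] := hx M k kM; exists N.
  exists N => //; have /filter_ex[M [kN _]] := hN; split => //.
  by apply: (@filterS _ at_oo) hN => M' [].
exists N => //.
have agree (s : seq G) : at_oo [set M | forall b, b \in s -> E b (x M) <-> B b].
  elim: s => [|b s IH]; first by apply: (@filterS _ at_oo _ setT) filterT.
  have hb : at_oo [set M | E b (x M) <-> B b].
    have [h|h] := in_ultra_setVsetC [set M | E b (x M)] at_oo_ultra.
      by apply: (@filterS _ at_oo) (h) => M /= EM; split.
    apply: (@filterS _ at_oo) (h) => M /= nEM; split => // hB.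
    by exfalso; have [M' [h1 h2]] := ultra_meet h hB; exact: h1.
  apply: (@filterS _ at_oo) (filterI hb IH) => M [h1 h2] b'.
  by rewrite in_cons => /predU1P[->|/h2].
have [M [SM hM]] := ultra_meet hN (agree (F N)).
apply: le_trans SM _; rewrite le_eqVlt; apply/orP; left; apply/eqP.
rewrite /g /avg; congr (_ / _); apply: eq_big_seq => b bF.
rewrite /ind; congr (_%:R); congr nat_of_bool; apply/idP/idP => /set_mem h; apply/mem_set.
  by apply/(hM b bF).
by apply/(hM b bF).
Qed.

End Intersectivity.

(** * Several pairs of polynomial maps at once *)

Section Products.
Variables (R : realType) (Gam1 Gam2 : groupType).
Variables (mu1 : (Gam1 -> R) -> R) (mu2 : (Gam2 -> R) -> R).
Hypothesis hmu1 : mean mu1.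
Hypothesis hmu2 : mean mu2.

Lemma mean_norm f (C : R) : (forall x, `|f x| <= C) -> `|mu2 f| <= C.
Proof.
move=> fC; have bf : bounded_map f by exists C.
rewrite ler_norml -[X in _ <= _ <= X](mean_cst hmu2) -[- C](mean_cst hmu2).
apply/andP; split; apply: (mean_le hmu2) => //; try exact: bounded_cst.
  by move=> x; have := fC x; rewrite ler_norml => /andP[].
by move=> x; have := fC x; rewrite ler_norml => /andP[].
Qed.

Definition prod_mean (f : Gam1 * Gam2 -> R) : R :=
  mu1 (fun x => mu2 (fun y => f (x, y))).

Lemma prod_mean_mean : mean prod_mean.
Proof.
have b2 (f : Gam1 * Gam2 -> R) x : bounded_map f -> bounded_map (fun y => f (x, y)).
  by move=> [C fC]; exists C.
have b1 (f : Gam1 * Gam2 -> R) : bounded_map f ->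
    bounded_map (fun x => mu2 (fun y => f (x, y))).
  by move=> [C fC]; exists C => x; exact: mean_norm.
split=> [f g bf bg|a f bf|f bf f0||[h k] f bf]; rewrite /prod_mean.
- rewrite -(meanD hmu1); try exact: b1.
  by congr mu1; apply: funext => x; rewrite (meanD hmu2) //; exact: b2.
- rewrite -(meanZ hmu1); last exact: b1.
  by congr mu1; apply: funext => x; rewrite (meanZ hmu2) //; exact: b2.
- apply: (mean_ge0 hmu1); first exact: b1.
  by move=> x; apply: (mean_ge0 hmu2); [exact: b2|].
- have -> : (fun x => mu2 (fun=> 1)) = fun x : Gam1 => 1.
    by apply: funext => x; exact: mean1.
  exact: mean1.
- rewrite -(mean_inv hmu1 h (b1 f bf)).
  congr mu1; apply: funext => x.
  by rewrite -(mean_inv hmu2 k (b2 f (h * x)%g bf)).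
Qed.

Lemma prod_mean_ind S1 S2 :
  prod_mean (ind [set x | S1 x.1 /\ S2 x.2]) = mu1 (ind S1) * mu2 (ind S2).
Proof.
rewrite /prod_mean mulrC -(meanZ hmu1); last exact: bounded_ind.
congr mu1; apply: funext => x; rewrite mulrC -(meanZ hmu2); last exact: bounded_ind.
congr mu2; apply: funext => y; rewrite /ind -natrM mulnb; congr (_%:R).
congr nat_of_bool; apply/idP/andP => [/set_mem[h1 h2]|[/set_mem h1 /set_mem h2]].
  by split; exact: mem_set.
exact: mem_set.
Qed.

Definition prod_fil (F1 : nat -> set Gam1) (F2 : nat -> set Gam2) i :
  set (Gam1 * Gam2) := [set x | F1 i x.1 /\ F2 i x.2].

Lemma prod_filtration F1 F2 : filtration F1 -> filtration F2 ->
  filtration (prod_fil F1 F2).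
Proof.
move=> h1 h2; split.
- by move=> i; split; [exact: (fil1 h1 i)|exact: (fil1 h2 i)].
- by move=> i x y [x1 x2] [y1 y2]; split; [exact: (filM h1 x1 y1)|exact: (filM h2 x2 y2)].
- by move=> i x [x1 x2]; split; [exact: (filV h1 x1)|exact: (filV h2 x2)].
- by move=> i x [x1 x2]; split; [exact: (filS h1 x1)|exact: (filS h2 x2)].
- by move=> i j x y [x1 x2] [y1 y2]; split; [exact: (filR h1 x1 y1)|exact: (filR h2 x2 y2)].
Qed.

Lemma prod_poly (T : Type) (op : T -> T -> T) F1 F2 i (s1 : T -> Gam1) (s2 : T -> Gam2) :
  poly op F1 i s1 -> poly op F2 i s2 ->
  poly op (prod_fil F1 F2) i (fun y => (s1 y, s2 y)).
Proof.
move=> h1 h2 n; elim: n i s1 s2 h1 h2 => [|n IH] i s1 s2 h1 h2.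
  by split => // y; split; [exact: poly_val h1 y|exact: poly_val h2 y].
split=> [y|x]; first by split; [exact: poly_val h1 y|exact: poly_val h2 y].
exact: (IH i.+1 (der op x s1) (der op x s2) (poly_der x h1) (poly_der x h2)).
Qed.

End Products.

Section Systems.
Local Open Scope group_scope.
Variables (R : realType) (G H : groupType) (A : set H).

Notation opr := (fun x y : G => y * x).

(** Products of groups reduce finitely many pairs [(p, q)] to a single pair
    [(P, Q)]; [S] stands for a power of [A]. *)
Definition controlled (L : (G -> H) -> (G -> H) -> Prop) : Prop :=
  exists (Gam : groupType) (F : nat -> set Gam) (m : nat)
    (mu : (Gam -> R) -> R) (P Q : G -> Gam) (S : set Gam),
  [/\ [/\ filtration F, forall i, (m <= i)%N -> F i `<=` [set 1], mean mu &
          (0 < mu (ind S))%R],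
      [/\ poly opr F 0 P, poly opr F 0 Q, P 1 = 1 & Q 1 = 1] &
      forall x b b', S (P b * x) -> S ((Q b')^-1 * x) ->
        forall p q, L p q ->
        exists a a', [/\ A a, A a' & p b * q b' = a * a'^-1]].

Variable mu : (H -> R) -> R.
Hypothesis hmu : mean mu.
Hypothesis muA : (0 < mu (ind A))%R.
Hypothesis hH : nilpotent_group H.

Lemma controlled_none : controlled (fun _ _ => False).
Proof.
have [m hm] := @lcfil_trivial H 1 isT hH.
have hF := @lcfil_filtration H 1 isT.
exists H, (@lcfil H 1), m, mu, (fun=> 1), (fun=> 1), A.
by do 2 split => //; exact: (poly1 opr hF).
Qed.

Lemma controlled_cons L p q : controlled L ->
  polynomial_map p -> polynomial_map q -> p 1 = 1 -> q 1 = 1 ->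
  controlled (fun p' q' => (p' = p /\ q' = q) \/ L p' q').
Proof.
move=> [Gam [F [m [nu [P [Q [S [[hF Fm hnu nuS] [hP hQ P1 Q1] hS]]]]]]]].
move=> /polynomial_map_poly[d hp] /polynomial_map_poly[d' hq] p1 q1.
pose D := (maxn d d').+1.
have hD := @lcfil_filtration H D isT.
have [m' hm'] := @lcfil_trivial H D isT hH.
exists (H * Gam)%type, (prod_fil (@lcfil H D) F), (maxn m m'),
  (prod_mean mu nu), (fun b => (p b, P b)), (fun b => (q b, Q b)),
  [set x | A x.1 /\ S x.2]; split.
- split; [exact: prod_filtration| |exact: prod_mean_mean|].
    move=> i; rewrite geq_max => /andP[mi m'i] [x y] [/= hx hy].
    by rewrite /= (hm' _ m'i _ hx) (Fm _ mi _ hy).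
  by rewrite prod_mean_ind // mulr_gt0.
- split; rewrite ?p1 ?q1 ?P1 ?Q1 //; apply: prod_poly => //.
    by apply: hp; rewrite ltnS leq_maxl.
  by apply: hq; rewrite ltnS leq_maxr.
move=> [x y] b b' [/= px Py] [/= qx Qy] p' q' [[-> ->]|Lpq]; last first.
  exact: (hS y b b' Py Qy p' q' Lpq).
by exists (p b * x), ((q b')^-1 * x); split => //; group_word.
Qed.

End Systems.

Section Generators.
Local Open Scope group_scope.
Variable G : groupType.

Lemma finitely_generated_seq : finitely_generated G ->
  exists X : seq G, gen X = setT.
Proof.
move=> [S [/finite_seqP[X ->] h]]; exists X.
by rewrite -h; congr generated.
Qed.

Lemma monoid_generators (op : G -> G -> G) (X : seq G) :
  (forall x y, op x y = x * y) \/ (forall x y, op x y = y * x) ->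
  gen X = setT ->
  forall P : set G, P 1 ->
  (forall x y, x \in X ++ [seq x^-1 | x <- X] -> P y -> P (op x y)) ->
  forall y, P y.
Proof.
move=> hop hX P P1 hP y.
have opx x z : x \in X -> P z -> P (op x z) /\ P (op x^-1 z).
  move=> xX Pz; split; apply: hP => //; first by rewrite mem_cat xX.
  by rewrite mem_cat map_f // orbT.
pose K := [set g | forall z, P z -> P (op g z) /\ P (op g^-1 z)].
have : gen X `<=` K.
  apply: generated_min => [|x xX z Pz]; last exact: opx.
  have opM g h z : op (g * h) z = op g (op h z) \/ op (g * h) z = op h (op g z).
    by case: hop => e; [left|right]; rewrite !e mulgA.
  split=> [z Pz|g h Kg Kh z Pz|g Kg z /Kg[h1 h2]]; last by rewrite invgK.
    by rewrite invg1; case: hop => ->; rewrite ?mul1g ?mulg1.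
  split.
    by case: (opM g h z) => ->; [apply: (Kg _ (Kh _ Pz).1).1|apply: (Kh _ (Kg _ Pz).1).1].
  rewrite invgM; case: (opM h^-1 g^-1 z) => ->.
    exact: (Kh _ (Kg _ Pz).2).2.
  exact: (Kg _ (Kh _ Pz).2).2.
rewrite hX => /(_ y I 1 P1)[+ _].
by case: hop => ->; rewrite ?mul1g ?mulg1.
Qed.

End Generators.

(** The sets [E b], of those [x] that [P b] and the inverse of [Q b] move into
    [S], have measure bounded below for a set of [b] of positive upper density, by
    recurrence for the product [P Q]; intersectivity then provides [B]. *)
Lemma large_set (R : realType) (G H : groupType) (A : set H)
  (L : (G -> H) -> (G -> H) -> Prop) (F : nat -> {fset G}) (X : seq G)
  (op : G -> G -> G) :
  (forall x y, op x y = x * y)%g \/ (forall x y, op x y = y * x)%g ->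
  gen X = setT -> (forall N, F N != fset0) ->
  (forall g : G,
    (fun N => #|` fset_symdiff [fset op g x | x in F N]%fset (F N)|%:R
            / #|` F N|%:R : R) @ \oo --> (0 : R)) ->
  @controlled R G H A L ->
  exists2 B : set G, 0 < upper_density R F B &
    forall b b', B b -> B b' -> forall p q, L p q ->
    exists a a', [/\ A a, A a' & (p b * q b' = a * a'^-1)%g].
Proof.
move=> hop hX F0 op_folner.
move=> [Gam [Fil [m [mu [P [Q [S [[hF Fm hmu muS] [hP hQ P1 Q1] hS]]]]]]]].
have opA : associative op by case: hop => e x y z; rewrite !e mulgA.
have op1l : left_id 1%g op by case: hop => e x; rewrite e ?mul1g ?mulg1.
have op1r : right_id 1%g op by case: hop => e x; rewrite e ?mul1g ?mulg1.
have op_inj g : injective (op g).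
  by case: hop => e x y; rewrite !e; [exact: mulgI|exact: mulIg].
have two_sided s : poly (fun x y : G => y * x)%g Fil 0 s -> poly op Fil 0 s.
  move=> hs; case: hop => e.
    have -> : op = fun x y => (x * y)%g by apply: funext => x; apply: funext.
    apply: (poly_comm (op := fun x y : G => (y * x)%g) (one := 1%g) hF) hs.
      by move=> x y z; rewrite mulgA.
    by move=> x; rewrite mul1g.
  by have -> : op = fun x y => (y * x)%g by apply: funext => x; apply: funext.
have [p [pU Fp pi]] := idempotent_ultrafilter opA
  (full_density_subidempotent F0 op_inj op_folner).
pose r b := (P b * Q b)%g.
have hr : poly op Fil 0 r by apply: (polyM hF); exact: two_sided.
have r1 : r 1%g = 1%g by rewrite /r P1 Q1 mulg1.
pose c := mu (ind S) ^+ 2 / 2.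
have a2 : 0 < mu (ind S) ^+ 2 by rewrite exprn_gt0.
have c0 : 0 < c by rewrite divr_gt0.
have pJ : p [set b | c <= mu (fun x => ind S ((r b)^-1 * x)%g * ind S x)].
  apply: (mean_recurrence opA op1l op1r (monoid_generators hop hX) pi hF Fm hmu hr r1).
  by rewrite /c; lra.
set J := [set b | _] in pJ.
have [|eta eta0 hJ] := @not_cvg0_frequently R G F F0 J.
  move=> J0; have nJ : p (~` J) by apply: Fp; rewrite /full_density /= setCK.
  by have [b [Jb nJb]] := ultra_meet pJ nJ.
pose E b := [set x | S (P b * x)%g /\ S ((Q b)^-1 * x)%g].
have mE b : J b -> c <= mu (ind (E b)).
  move=> /le_trans; apply.
  have bf : bounded_map (fun x => ind S ((r b)^-1 * x)%g * ind S x : R).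
    by apply: bounded_mul; [apply: bounded_comp|]; exact: bounded_ind.
  rewrite -(mean_inv hmu (P b) bf).
  rewrite le_eqVlt; apply/orP; left; apply/eqP; congr mu; apply: funext => x.
  rewrite /ind -natrM mulnb mulgA /r invgM mulgVK; congr (_%:R).
  congr nat_of_bool; apply/andP/idP => [[/set_mem h1 /set_mem h2]|/set_mem[h1 h2]].
    by apply: mem_set; split.
  by split; exact: mem_set.
have [B dB hB] := intersectivity hmu F0 c0 eta0 mE hJ.
exists B => // b b' Bb Bb' p' q' Lpq.
have [x [Px _] [_ Qx]] := hB b b' Bb Bb'.
exact: hS Px Qx _ _ Lpq.
Qed.

Theorem theorem1p46 (R : realType) (G H : groupType)
  (hG : finitely_generated G)
  (hHcount : countable [set: H]) (hHnil : nilpotent_group H)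
  (s : nat) (p q : 'I_s -> G -> H)
  (hp : forall j, polynomial_map (p j)) (hq : forall j, polynomial_map (q j))
  (hp1 : forall j, p j 1%g = 1%g) (hq1 : forall j, q j 1%g = 1%g)
  (A : set H) (hA : 0 < left_upper_banach_density R A)
  (F : nat -> {fset G}) (hF : left_folner R F \/ right_folner R F) :
  exists B : set G,
    0 < upper_density R F B /\
    \bigcup_(j in [set: 'I_s]) [set (p j b * q j b')%g | b in B & b' in B]
      `<=` [set (a * a'^-1)%g | a in A & a' in A].
Proof.
have [Phi hPhi dPhi] : exists2 Phi, left_folner R Phi & 0 < upper_density R Phi A.
  apply: contrapT => none.
  move: hA; rewrite /left_upper_banach_density ltNge => /negP; apply.
  set D := [set _ | _ in _]; have [->|/set0P D0] := eqVneq D set0; first by rewrite sup0.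
  apply: ge_sup => // _ [Phi hPhi <-]; rewrite leNgt; apply/negP => h.
  by apply: none; exists Phi.
have [mu hmu muA] := folner_mean hPhi dPhi.
have [X hX] := finitely_generated_seq hG.
have ctrl n : (n <= s)%N -> @controlled R G H A
    (fun p' q' => exists j : 'I_s, [/\ (j < n)%N, p' = p j & q' = q j]).
  elim: n => [_|n IH ns].
    have [Gam [Fil [m [nu [P [Q [S [h1 h2 h3]]]]]]]] := controlled_none G hmu muA hHnil.
    by exists Gam, Fil, m, nu, P, Q, S; split => // x b b' _ _ p' q' [j []].
  pose j := Ordinal ns.
  have [Gam [Fil [m [nu [P [Q [S [h1 h2 h3]]]]]]]] := controlled_cons hmu muA hHnil
    (IH (ltnW ns)) (hp j) (hq j) (hp1 j) (hq1 j).
  exists Gam, Fil, m, nu, P, Q, S; split => // x b b' Sx Sx' p' q' [i [ni -> ->]].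
  apply: (h3 x) => //; move: ni; rewrite ltnS leq_eqVlt => /predU1P[ni|ni].
    by left; have -> : i = j by exact: val_inj.
  by right; exists i.
have [B dB hB] : exists2 B : set G, 0 < upper_density R F B &
    forall b b', B b -> B b' -> forall j,
    exists a a', [/\ A a, A a' & (p j b * q j b' = a * a'^-1)%g].
  have fin op : (forall x y, op x y = x * y)%g \/ (forall x y, op x y = y * x)%g ->
      (forall N, F N != fset0) -> (forall g : G,
        (fun N => #|` fset_symdiff [fset op g x | x in F N]%fset (F N)|%:R
            / #|` F N|%:R : R) @ \oo --> (0 : R)) ->
      exists2 B : set G, 0 < upper_density R F B &
      forall b b', B b -> B b' -> forall j,
      exists a a', [/\ A a, A a' & (p j b * q j b' = a * a'^-1)%g].
    move=> hop F0 Ff; have [B dB hB] := large_set hop hX F0 Ff (ctrl s (leqnn s)).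
    by exists B => // b b' Bb Bb' j; apply: (hB b b' Bb Bb'); exists j.
  case: hF => -[F0 Ff].
    by apply: (fin (fun x y => x * y)%g) => //; left.
  by apply: (fin (fun x y => y * x)%g) => //; right.
exists B; split => // _ [j _ [b Bb [b' Bb' <-]]].
by have [a [a' [Aa Aa' ->]]] := hB b b' Bb Bb' j; exists a => //; exists a'.
Qed.
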